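(* Let $k$ be a positive integer, let $\lambda\in \mathrm{sP}_\ell^k$ be a strictly decreasing $k$-bounded partition of length $\ell$, and let $m\in\mathbb{Z}_{\ge 0}$. Then the coefficients $c_{\lambda\mu}$ in the expansion $$G_{1^m}^{\perp}\,\tilde{\mathfrak g}^{(k)}_{\lambda}=\sum_{\mu} c_{\lambda\mu}\,\tilde{\mathfrak g}^{(k)}_{\mu},$$ where $\mu$ runs over $k$-bounded partitions, satisfy $(-1)^{|\lambda|-|\mu|-m}c_{\lambda\mu}\in\mathbb{Z}_{\ge 0}$ for all $\mu$.
   Context: $e_d$, $h_d$ are the elementary and complete homogeneous symmetric functions. For $m\in\mathbb{Z}$, $r\in\mathbb{Z}_{\ge0}$ put $k_m^{(r)}:=\sum_{i=0}^{m}\binom{r+i-1}{i}h_{m-i}$, with $k_m^{(r)}=0$ for $m<0$ and $k_m^{(0)}=h_m$. For $\gamma\in\mathbb{Z}^\ell$ let $k_\gamma:=k^{(0)}_{\gamma_1}k^{(1)}_{\gamma_2}\cdots k^{(\ell-1)}_{\gamma_\ell}$ and $g_\gamma:=\det(k^{(i-1)}_{\gamma_i+j-i})_{1\le i,j\le\ell}$. Let $\epsilon_i\in\mathbb{Z}^\ell$ be the $i$-th unit vector and $\Delta_\ell^+:=\{(i,j):1\le i<j\le\ell\}$. A root ideal is a subset $\Psi\subseteq\Delta_\ell^+$ such that $(a,b)\in\Psi$, $(c,d)\in\Delta_\ell^+$, $c\le a$, $d\ge b$ imply $(c,d)\in\Psi$. For a root ideal $\Psi$, a finite multiset $M$ supported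 in $[\ell]=\{1,\dots,\ell\}$ and $\gamma\in\mathbb{Z}^\ell$, the Katalan function is $$K(\Psi;M;\gamma):=\prod_{z\in M}(1-L_z)\prod_{(i,j)\in\Psi}(1-R_{ij})^{-1}g_\gamma=\prod_{z\in M}(1-L_z)\prod_{(i,j)\in\Delta_\ell^+\setminus\Psi}(1-R_{ij})\,k_\gamma,$$ where $L_z$ and $R_{ij}$ act on subscripts: $L_zg_\gamma=g_{\gamma-\epsilon_z}$, $R_{ij}g_\gamma=g_{\gamma+\epsilon_i-\epsilon_j}$, and likewise on $k_\gamma$ (products of operators are expanded first, then applied to the subscript). A partition is $k$-bounded if all its parts are $\le k$. $\mathrm{P}_\ell^k$ is the set of $k$-bounded partitions of length $\ell$, written as sequences $k\ge\lambda_1\ge\dots\ge\lambda_\ell\ge0$, and $\mathrm{sP}_\ell^k:=\{\lambda\in \mathrm{P}_\ell^k:\lambda_x>\lambda_{x+1}\ \forall x\in[\ell-1]\}$ (with the convention $\mathrm{sP}_0^k=\mathrm{P}_0^k=\emptyset$). For $\lambda\in\mathrm{P}_\ell^k$ let $\Delta^k(\lambda):=\{(i,j)\in\Delta_\ell^+: k-\lambda_i+i<j\}$ (a root ideal) and let $L(\Delta^k(\lambda))$ be the multiset of second components $j$ of the elements $(i,j)\in\Delta^k(\lambda)$. The closed $k$-Schur Katalan function is $\tilde{\mathfrak g}^{(k)}_\lambda:=K\big(\Delta^k(\lambda);L(\Delta^k(\lambda));\lambda\big)$; appending trailing zeros to $\lambda$ does not change it. The $\tilde{\mathfrak g}^{(k)}_\mu$,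 with $\mu$ ranging over all $k$-bounded partitions (of any length, trailing zeros ignored), form a basis of $\Lambda_{(k)}=\mathbb{Q}[h_1,\dots,h_k]$. $|\mu|$ denotes the sum of the parts. $G_{1^m}:=\sum_{i\ge 0}(-1)^i\binom{m-1+i}{m-1}e_{m+i}$ (with $G_{1^0}=1$), and $f^\perp$ is the operator adjoint to multiplication by $f$ under the Hall inner product, extended linearly to the infinite sum $G_{1^m}$ (only finitely many terms act nontrivially on a given symmetric function). *)

(* Defs.v *)
From Stdlib Require Import ClassicalEpsilon.
From HB Require Import structures.
From mathcomp Require Import all_boot all_order all_algebra.
From mathcomp Require Import finmap.
From mathcomp Require Import monalg.
From mathcomp Require Import mpoly.

Set Implicit Arguments.
Unset Strict Implicit.
Unset Printing Implicit Defensive.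

Import Order.TTheory GRing.Theory Num.Theory.

Local Open Scope ring_scope.

(* ------------------------------------------------------------------ *)
(* The ring of symmetric functions over rat, presented as the polynomial
   ring in h_1, h_2, h_3, ...; the variable of index i : nat is h_{i+1}.
   A monomial a : hmon is thus h_nu for the partition nu having a i parts
   equal to i+1. *)

Definition hmon := {cmonom nat}.
Definition Sym := {malg rat[hmon]}.

Definition hh (d : nat) : Sym :=
  if d is d'.+1 then monalg.mkmalgU (monalg.ucm d') 1 else 1.

Definition hparts (a : hmon) : seq nat :=
  flatten [seq nseq (a i) i.+1 | i <- finsupp a].

Definition hdeg (u : Sym) : nat :=
  (\max_(a <- monalg.msupp u) sumn (hparts a))%N.

(* h_d(x_1, ..., x_n), as a sum of monomials.  The notations {mpoly _[_]} and
   'X_{1.._} denote here the types of monalg; those of mpoly are written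
   mpoly n R and multinom n. *)
Definition hpoly (n d : nat) : mpoly n rat :=
  \sum_(M : 'X_{1..n < d.+1} | mdeg M == d) 'X_[M].

Definition hmonX (n : nat) (a : hmon) : mpoly n rat :=
  \prod_(i <- finsupp a) hpoly n i.+1 ^+ a i.

(* The image of u in n variables, h_d being sent to h_d(x_1, ..., x_n). *)
Definition toX (n : nat) (u : Sym) : mpoly n rat :=
  monalg.mmap (@mpolyC n rat) (hmonX n) u.

(* e_d, by sum_(i <= d) (-1)^i h_i e_(d-i) = 0 for d > 0.
   eseq d is the list e_d, ..., e_0; see toX_ee. *)
Fixpoint eseq (d : nat) : seq Sym :=
  if d is d'.+1 then
    (\sum_(i < d) (-1) ^+ i * hh i.+1 * (eseq d')`_i) :: eseq d'
  else [:: 1].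

Definition ee (d : nat) : Sym := head 0 (eseq d).

(* The definitions agree with the usual ones: toX n is a ring morphism
   sending h_d and e_d to h_d(x_1, ..., x_n) and e_d(x_1, ..., x_n). *)

Lemma hmonXE n (a : hmon) (D : {fset nat}) : (finsupp a `<=` D)%fset ->
  hmonX n a = \prod_(i <- D) hpoly n i.+1 ^+ a i.
Proof.
move=> le; rewrite /hmonX (big_fset_incl _ le) // => i _.
by rewrite -cmE_eq0 => /eqP ->; rewrite expr0.
Qed.

Lemma hmonX_mmorphism n : mmorphism (hmonX n).
Proof.
split=> [a b|]; last by rewrite /hmonX mdom1 big_seq_fset0.
rewrite (hmonXE _ (fsubsetUl (finsupp a) (finsupp b))).
rewrite (hmonXE _ (fsubsetUr (finsupp a) (finsupp b))).
rewrite /hmonX mdomD -big_split /=; apply: eq_bigr => i _.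
by rewrite cmM exprD.
Qed.

HB.instance Definition _ n :=
  monalg.isMultiplicative.Build hmon (mpoly n rat) (hmonX n)
    (hmonX_mmorphism n).
HB.instance Definition _ n := GRing.RMorphism.copy (toX n)
  (monalg.mmap (@mpolyC n rat) (hmonX n)).

Lemma hpoly0 n : hpoly n 0 = 1.
Proof.
rewrite /hpoly (big_pred1 (bm0 : bmultinom n 1)) => [|M]; first by rewrite mpolyX0.
by rewrite mpoly.mdeg_eq0.
Qed.

Lemma toX_hh n d : toX n (hh d) = hpoly n d.
Proof.
case: d => [|d]; first by rewrite /= rmorph1 hpoly0.
rewrite /toX /hh monalg.mmapU /= mpolyC1 mul1r /hmonX mdomU big_seq_fset1.
by rewrite cmUU expr1.
Qed.

Lemma mcoeff_hpoly n d (M : multinom n) :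
  mpoly.mcoeff M (hpoly n d) = (mdeg M == d)%:R.
Proof.
rewrite /hpoly raddf_sum /=; case: eqP => [dM|dM].
  have lt : (mdeg M < d.+1)%N by rewrite dM.
  rewrite (bigD1 (BMultinom lt)) /= ?dM //= mcoeffX eqxx big1 ?addr0 // => N.
  by rewrite mcoeffX -val_eqE /= => /andP[_ /negPf ->].
rewrite big1 // => N /eqP dN; rewrite mcoeffX; case: eqP => // eM.
by case: dM; rewrite -eM.
Qed.

Lemma mcoeff_hpolyX n d (A : {set 'I_n}) (M : multinom n) :
  mpoly.mcoeff M (hpoly n d * mpolyX rat (mesym1 A)) =
  ((mesym1 A <= M)%MM && (mpoly.mdeg M == d + #|A|)%N)%:R.
Proof.
case: (boolP (mesym1 A <= M)%MM) => [le|nle] /=.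
  rewrite -{1}(submK le) addmC mcoeffMX mcoeff_hpoly; congr (_%:R); congr nat_of_bool.
  by rewrite -[in RHS](submK le) mpoly.mdegD mdeg_mesym1 eqn_add2r.
rewrite mpoly.mcoeffM big1 // => -[K1 K2] /= /eqP eM.
rewrite mcoeffX; case: eqP => [eK|_]; last by rewrite mulr0.
case/negP: nle; apply/mnm_lepP => i.
have := congr1 (fun N : multinom n => N i) eM.
by rewrite /= mnmDE -eK => ->; rewrite leq_addl.
Qed.

Lemma sum_sign_sub n (M : multinom n) : (0 < mpoly.mdeg M)%N ->
  \sum_(A : {set 'I_n} | (mesym1 A <= M)%MM) (-1) ^+ #|A| = 0 :> rat.
Proof.
move=> dM; have [x Mx] : exists x, (0 < M x)%N.
  apply/existsP; apply: contraLR dM => /existsPn M0; rewrite -eqn0Ngt.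
  by rewrite mpoly.mdegE big1 // => i _; apply/eqP; rewrite eqn0Ngt M0.
pose tg (A : {set 'I_n}) := if x \in A then A :\ x else x |: A.
have tgK : involutive tg.
  move=> A; rewrite /tg; case: (boolP (x \in A)) => xA.
    by rewrite !inE eqxx /= setD1K.
  by rewrite setU11 setU1K.
have tgM A : (mesym1 (tg A) <= M)%MM = (mesym1 A <= M)%MM.
  apply/mnm_lepP/mnm_lepP => le i; have := le i; rewrite !mnmE /tg;
    case: (eqVneq i x) => [->|ne]; try by move=> _; apply: leq_trans Mx; case: (_ \in _).
    by case: ifP => _; rewrite !inE (negPf ne).
  by case: ifP => _; rewrite !inE (negPf ne).
have tgs A : (-1) ^+ #|tg A| = - (-1) ^+ #|A| :> rat.
  rewrite /tg; case: (boolP (x \in A)) => xA.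
    by rewrite [in RHS](cardsD1 x) xA exprS mulN1r opprK.
  by rewrite cardsU1 xA exprS mulN1r.
set S := \sum_(A | _) _; suff : S = - S.
  by move/eqP; rewrite -addr_eq0 -mulr2n mulrn_eq0 => /eqP.
rewrite {1}/S (reindex_inj (inv_inj tgK)) /= -sumrN.
by apply: eq_big => A; rewrite ?tgM ?tgs.
Qed.

Lemma sum_hpoly_mesym n d : (0 < d)%N ->
  \sum_(j < d.+1) (-1) ^+ j * (hpoly n (d - j) * mesym n rat j) = 0.
Proof.
move=> d0; apply/mpolyP => M; rewrite mpoly.mcoeff0 raddf_sum /=.
pose F (A : {set 'I_n}) : rat :=
  (-1) ^+ #|A| * ((mesym1 A <= M)%MM && (mpoly.mdeg M == d))%:R.
have le_A (A : {set 'I_n}) : F A != 0 -> (#|A| < d.+1)%N.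
  rewrite /F mulf_eq0 negb_or pnatr_eq0 eqb0 negbK => /andP[_ /andP[le /eqP dM]].
  by rewrite ltnS -dM -(submK le) mpoly.mdegD mdeg_mesym1 leq_addl.
transitivity (\sum_A F A); last first.
  case: (eqVneq (mpoly.mdeg M) d) => dM; last first.
    by apply: big1 => A _; rewrite /F (negPf dM) andbF mulr0.
  rewrite -[RHS](@sum_sign_sub n M) ?dM // [RHS]big_mkcond /=.
  by apply: eq_bigr => A _; rewrite /F dM eqxx andbT; case: ifP; rewrite ?mulr1 ?mulr0.
have -> : \sum_A F A = \sum_(A : {set 'I_n}) \sum_(j < d.+1 | #|A| == j) F A.
  apply: eq_bigr => A _; have [lt|] := ltnP #|A| d.+1.
    by rewrite (big_pred1 (Ordinal lt)) // => j; rewrite -val_eqE /= eq_sym.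
  rewrite ltnNge -ltnS; case: (eqVneq (F A) 0) => [->|/le_A ->] //.
  by rewrite big1.
rewrite (exchange_big_dep xpredT) //=; apply: eq_bigr => j _.
rewrite mesymE mulr_sumr mulr_sumr raddf_sum /=; apply: eq_bigr => A /eqP dA.
rewrite -[X in X * _]signr_odd mulr_sign.
have -> : forall (b : bool) (p : mpoly n rat), 
  mpoly.mcoeff M (if b then - p else p) = (-1) ^+ b * mpoly.mcoeff M p.
  by case=> p; rewrite ?mpoly.mcoeffN ?expr1 ?mulN1r ?expr0 ?mul1r.
rewrite signr_odd mcoeff_hpolyX /F dA subnK //.
by rewrite -ltnS.
Qed.

Lemma nth_eseq d i : (i <= d)%N -> (eseq d)`_i = ee (d - i).
Proof.
elim: d i => [|d IHd] [|i] //= le_id.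
by rewrite IHd // subSS.
Qed.

Lemma eeS d :
  ee d.+1 = \sum_(i < d.+1) (-1) ^+ i * hh i.+1 * ee (d - i).
Proof.
rewrite {1}/ee; apply: eq_bigr => i _.
by rewrite nth_eseq // -ltnS.
Qed.

Lemma toX_ee n d : toX n (ee d) = mesym n rat d.
Proof.
elim/ltn_ind: d => -[|d] IHd; first by rewrite rmorph1 mesym0E.
have := @sum_hpoly_mesym n d.+1 isT.
rewrite big_ord_recr /= subnn hpoly0 mul1r => /eqP.
rewrite addrC addr_eq0 => /eqP eE.
apply: (can_inj (signrMK d.+1)); rewrite eE eeS rmorph_sum -sumrN mulr_sumr.
rewrite (reindex_inj rev_ord_inj) /=; apply: eq_bigr => i _.
have le_i : (i <= d)%N by rewrite -ltnS.
rewrite !rmorphM rmorph_sign subSS subKn //=.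
rewrite [X in _ * (_ * X * _)](toX_hh n (d - i).+1).
rewrite [X in _ * (_ * _ * X)]IHd // -subSn //.
rewrite exprS -[in (-1) ^+ d](subnK le_i) exprD mulN1r mulNr; congr (- _).
by rewrite [X in X * _]mulrC -!mulrA signrMK.
Qed.

(* The coefficient of the monomial function m_nu in v, read off as the
   coefficient of x^nu in size nu variables; the order of the parts is
   irrelevant, v being symmetric. *)
Definition mcoef (nu : seq nat) (v : Sym) : rat :=
  (toX (size nu) v)@_(Multinom (in_tuple nu)).

(* The Hall inner product: <h_nu, m_mu> = delta_(nu, mu). *)
Definition hall (u v : Sym) : rat :=
  \sum_(a <- monalg.msupp u) monalg.mcoeff a u * mcoef (hparts a) v.

Definition is_adjoint (f : Sym) (D : Sym -> Sym) : Prop :=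
  forall u v : Sym, hall (D u) v = hall u (f * v).

(* f^perp; the adjoint is unique as the Hall inner product is
   nondegenerate. *)
Definition perp (f : Sym) : Sym -> Sym :=
  epsilon (inhabits id) (is_adjoint f).

(* The coefficient of e_(m+i) in G_(1^m); G_(1^0) = 1. *)
Definition Gcoef (m i : nat) : rat :=
  if m is m'.+1 then (-1) ^+ i * 'C(m' + i, m')%:R else (i == 0%N)%:R.

(* e_d^perp lowers the degree by d, so that the terms of G_(1^m)^perp u
   with m + i > hdeg u vanish. *)
Definition Gperp (m : nat) (u : Sym) : Sym :=
  \sum_(i < (hdeg u).+1) Gcoef m i *: perp (ee (m + i)) u.

(* ------------------------------------------------------------------ *)

(* k_m^(r); for r = i = 0 the binomial ((-1) choose 0) = 1 is 'C(0, 0),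
   and for r = 0 < i, ((i-1) choose i) = 0. *)
Definition kk (r : nat) (m : int) : Sym :=
  if m is Posz m' then
    \sum_(i < m'.+1) 'C((r + i).-1, i)%:R *: hh (m' - i)
  else 0.

(* Positions 1, ..., l are numbered 0, ..., l-1. *)
Section Katalan.
Variable l : nat.

Definition weight := {ffun 'I_l -> int}.

Definition kprod (gam : weight) : Sym := \prod_(i < l) kk i (gam i).

Definition eps (i : 'I_l) : weight := [ffun j => (j == i)%:R].

(* 1 - T, for T the operator acting on subscripts by gam |-> gam + al. *)
Definition one_minus_shift (al : weight) (F : weight -> Sym) : weight -> Sym :=
  fun gam => F gam - F (gam + al).

Definition one_minus_L (z : 'I_l) := one_minus_shift (- eps z).
Definition one_minus_R (ij : 'I_l * 'I_l) :=
  one_minus_shift (eps ij.1 - eps ij.2).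

Definition posroots : {set 'I_l * 'I_l} := [set ij : 'I_l * 'I_l | (ij.1 < ij.2)%N].

(* The multiset M is given by a list of its elements.  The operators
   commute, so the order in which they are composed is irrelevant. *)
Definition Katalan (Psi : {set 'I_l * 'I_l}) (M : seq 'I_l) (gam : weight) :
    Sym :=
  foldr one_minus_L
    (foldr one_minus_R kprod (enum (posroots :\: Psi))) M gam.

(* The truncated subtraction is exact, as lam_i <= k. *)
Definition Delta (k : nat) (lam : l.-tuple nat) : {set 'I_l * 'I_l} :=
  [set ij : 'I_l * 'I_l in posroots | (k - tnth lam ij.1 + ij.1 < ij.2)%N].

Definition Lset (Psi : {set 'I_l * 'I_l}) : seq 'I_l :=
  [seq ij.2 | ij <- enum Psi].

Definition gtilde (k : nat) (lam : l.-tuple nat) : Sym :=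
  Katalan (Delta k lam) (Lset (Delta k lam)) [ffun i => (tnth lam i)%:Z].

(* By convention there is no such partition of length 0. *)
Definition Pkl (k : nat) : pred (l.-tuple nat) :=
  fun lam => [&& (0 < l)%N, sorted geq lam & all (leq^~ k) lam].

Definition sPkl (k : nat) : pred (l.-tuple nat) :=
  fun lam => Pkl k lam && sorted gtn lam.

End Katalan.

(* k-bounded partitions of any length, without trailing zeros. *)
Definition is_kpart (k : nat) (mu : seq nat) : bool :=
  sorted geq mu && all (fun x => 0 < x <= k)%N mu.

Definition kpart (k : nat) : Type := {mu : seq nat | is_kpart k mu}.
HB.instance Definition _ (k : nat) := Choice.on (kpart k).

Definition gtilde_part (k : nat) (mu : kpart k) : Sym :=
  gtilde k (in_tuple (val mu)).

(* c is the family of coefficients of u on the gtilde_mu; a family in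
   {fsfun _ with 0} is zero outside of its finite support. *)
Definition gtilde_expansion (k : nat) (u : Sym)
    (c : {fsfun kpart k -> rat with 0}) : Prop :=
  u = \sum_(mu <- finsupp c) c mu *: gtilde_part mu.

(* Main.v *)
From Stdlib Require Import ClassicalEpsilon.
From HB Require Import structures.
From mathcomp Require Import all_boot all_order all_algebra.
From mathcomp Require Import fingroup perm finmap ring zify.
From mathcomp Require Import monalg.
From mathcomp Require Import mpoly.
Require Import Defs.

Set Implicit Arguments.
Unset Strict Implicit.
Unset Printing Implicit Defensive.

Import Order.TTheory GRing.Theory Num.Theory.

Local Open Scope ring_scope.

(** The idea is to trade operators on subscripts for polynomials.

Rows and variables are numbered from 0.  Let [kphi] be the linear map sending a
monomial x^m in l variables to [k_(c - m)], where c = (k, ..., k).  Put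
[x_j = 0] for [j >= l] and [y_j = 1 - x_j].  If [n_i = k - lambda_i] is the
defect of row [i], then ([gtildeE]) the function attached to lambda is the image
under [kphi] of the product over the rows [i] of
  [krow i n_i] = prod_(i < j <= i + n_i) (x_i - x_j) * prod_(j > i + n_i) y_j.
The point of this normalisation is that c does not depend on lambda: lowering
lambda_i by one only turns the factor [y_e], for [e = i + n_i + 1], into
[x_i - x_e].  As [y_e - (x_i - x_e) = y_i], this reads
  [y_i] * (row [i] without [y_e]) = [krow i n_i] - [krow i (n_i + 1)].
On the other hand [e_d]^perp becomes the multiplication by the d-th elementary
polynomial in the variables ([eperp_keval]), so that [G_(1^m)]^perp is a
combination of multiplications by square-free monomials x_S, with coefficients
of sign (-1)^(|S| - m).  The theorem thus reduces to one claim
([expands_xpart]): for lambda strict, x_S times the product of the rows expands,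
under [kphi], into the functions of smaller partitions mu, with signs
(-1)^(|lambda| - |mu| - |S|).

Multiplying by x_s amounts to multiplying by [y_s = 1 - x_s].  If all defects
were distinct, one could follow the chain s, [e_s], [e_(e_s)], ...: since
[krow z n_z] contains the factor [y_(e_z)], the factor [y_s] can be exchanged
for the next [y] of the chain, at the price of turning row z into the
difference [krow z n_z - krow z (n_z + 1)].  At the end of the chain no factor
is left, and expanding the differences gives an alternating sum over the
subsets of the chain.  When [n_z = n_(z+1)], lowering row z would not give a
partition; but then replacing [y_z] by [y_(e_z)] costs nothing, because the
difference is killed by [kphi] ([chain]).  The reason is a symmetry: as
[k_m^(w+1) - k_(m-1)^(w+1) = k_m^(w)], the value of [kphi (y_(w+1) * h)] is
unchanged when x_w and x_(w+1) are exchanged in h ([kphi_swap]), so that it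
vanishes for h antisymmetric.  Rows z and z+1 with equal defects make the
relevant product antisymmetric; when several such rows follow one another on a
chain, the vanishing is passed along ([kills_anti_bad]).

Strictness of lambda enters as follows: multiply by the variables of x_S in
decreasing order of the index.  When x_t is reached, rows up to t are
untouched and the rows below have only been lowered, so that row t is still
strictly longer than the next one, and the chain that starts at t begins with
a row that can be lowered.

Two facts on symmetric functions complete the proof: the adjoint of e_d is the
d-th coefficient of the ring morphism h_m |-> h_m + h_(m-1) X ([perp_ee]), and
the functions attached to k-bounded partitions are linearly independent, as
each has a leading term h_mu for the order that compares degrees and then sums
of squares of parts ([gtilde_leading], [gtilde_part_free]). *)


(** * Subscripts as exponents *)

Lemma kkE (r m : nat) :
  kk r m%:Z = \sum_(i < m.+1) 'C((r + i).-1, i)%:R *: hh (m - i).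
Proof. by []. Qed.

Lemma kkS_diff (r : nat) (m : int) : kk r.+1 m - kk r.+1 (m - 1) = kk r m.
Proof.
have kk_neg n : kk r.+1 (Negz n) = 0 by [].
case: m => [[|m]|m].
- have -> : Posz 0 - 1 = Negz 0 by lia.
  rewrite kk_neg subr0 !kkE [LHS]big_ord_recl big_ord0 [RHS]big_ord_recl big_ord0.
  by rewrite !bin0.
- have -> : m.+1%:Z - 1 = m%:Z by lia.
  rewrite !kkE [X in X - _]big_ord_recl [RHS]big_ord_recl !bin0 -addrA.
  congr (_ + _); rewrite -sumrB; apply: eq_bigr => i _.
  rewrite !lift0 subSS -[LHS]scalerBl addSn addnS !PeanoNat.Nat.pred_succ.
  by rewrite binS natrD addrK.
- have -> : Negz m - 1 = Negz m.+1 by lia.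
  by rewrite !kk_neg subr0.
Qed.

Section Evaluation.
Variable l : nat.
Implicit Types (c : weight l) (p q h : mpoly l rat).

Definition kmon c (m : multinom l) : Sym := kprod [ffun i => c i - (m i)%:Z].

(** The operator lowering the [i]-th subscript becomes the multiplication by the
[i]-th variable, so that relations between subscripts are checked on polynomials. *)
Definition keval c p : Sym := \sum_(m <- msupp p) p@_m *: kmon c m.

Lemma keval_wide c p (s : seq (multinom l)) : uniq s -> {subset msupp p <= s} ->
  keval c p = \sum_(m <- s) p@_m *: kmon c m.
Proof.
move=> us ss; rewrite [RHS](bigID (mem (msupp p))) /= [X in _ + X]big1 ?addr0.
  rewrite -[RHS]big_filter; apply: perm_big; apply: uniq_perm => //.
  - exact: filter_uniq.
  - by move=> m; rewrite mem_filter; case: (boolP (m \in msupp p)) => [/ss ->|].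
by move=> m /memN_msupp_eq0 ->; rewrite scale0r.
Qed.

Lemma keval_is_linear c : linear (keval c).
Proof.
move=> a p q; pose s := undup (msupp p ++ msupp q).
have us : uniq s by exact: undup_uniq.
have sp : {subset msupp p <= s} by move=> m mp; rewrite mem_undup mem_cat mp.
have sq : {subset msupp q <= s} by move=> m mp; rewrite mem_undup mem_cat mp orbT.
have spq : {subset msupp (a *: p + q) <= s}.
  move=> m; rewrite mcoeff_msupp mem_undup mem_cat !mcoeff_msupp mcoeffD mcoeffZ.
  by apply: contraR; rewrite negb_or !negbK => /andP[/eqP -> /eqP ->]; rewrite mulr0 addr0.
rewrite (keval_wide c us spq) (keval_wide c us sp) (keval_wide c us sq).
rewrite scaler_sumr -big_split /=; apply: eq_bigr => m _.
by rewrite mcoeffD mcoeffZ scalerDl scalerA.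
Qed.

HB.instance Definition _ c :=
  GRing.isLinear.Build rat (mpoly l rat) Sym *:%R (keval c) (keval_is_linear c).

Lemma kevalX c m : keval c 'X_[m] = kmon c m.
Proof. by rewrite /keval msuppX big_seq1 mcoeffX eqxx scale1r. Qed.

(** Extending the variables by zero beyond [l] lets a row that has no root be
treated like the others: a factor [xv i - xv j] with [l <= j] is just [xv i]. *)
Definition xv (j : nat) : mpoly l rat := if insub j is Some i then 'X_i else 0.
Definition yv (j : nat) : mpoly l rat := 1 - xv j.

Lemma xv_ord (i : 'I_l) : xv i = 'X_i.
Proof. by rewrite /xv valK. Qed.

Lemma xv0 j : (l <= j)%N -> xv j = 0.
Proof. by move=> lj; rewrite /xv insubN // -leqNgt. Qed.

Lemma yv1 j : (l <= j)%N -> yv j = 1.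
Proof. by move=> lj; rewrite /yv xv0 // subr0. Qed.

Definition swapv (w : nat) : mpoly l rat -> mpoly l rat :=
  msym (match insub w, insub w.+1 with
        | Some i, Some j => tperm i j | _, _ => 1%g end).

HB.instance Definition _ w := GRing.RMorphism.copy (swapv w) (swapv w).
HB.instance Definition _ w := GRing.Linear.copy (swapv w) (swapv w).

Lemma swapvE w (lw : (w.+1 < l)%N) :
  swapv w = msym (tperm (Ordinal (ltnW lw)) (Ordinal lw)).
Proof.
by rewrite /swapv (insubT (fun i => i < l)%N (ltnW lw)) (insubT (fun i => i < l)%N lw).
Qed.

Lemma swapv_xv w j : (w.+1 < l)%N ->
  swapv w (xv j) = xv (if j == w then w.+1 else if j == w.+1 then w else j).
Proof.
move=> lw; rewrite (swapvE lw); have [lj|lj] := ltnP j l; last first.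
  by rewrite xv0 // msym0 ifN ?ifN ?xv0 //; apply/negP => /eqP ej; move: lj; rewrite ej; lia.
have -> : xv j = 'X_(Ordinal lj) by rewrite -xv_ord.
rewrite msymX; set s := tperm _ _.
have -> : [multinom U_(Ordinal lj)%MM ((s^-1)%g i) | i < l] = U_(s (Ordinal lj))%MM.
  apply/mnmP => i; rewrite !mnmE; congr nat_of_bool.
  by rewrite -(inj_eq (@perm_inj _ s)) permKV.
rewrite -xv_ord; congr xv; rewrite /s.
case: tpermP => [/(congr1 val) /= ->|/(congr1 val) /= ->|/eqP oi /eqP oj] /=; rewrite ?eqxx //.
  by rewrite eqn_leq ltnn.
by move: oi oj; rewrite -!val_eqE /= => /negPf -> /negPf ->.
Qed.

Lemma swapv_xv_id w j : (w.+1 < l)%N -> j != w -> j != w.+1 -> swapv w (xv j) = xv j.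
Proof. by move=> lw /negPf jw /negPf jw1; rewrite swapv_xv // jw jw1. Qed.

Lemma swapv_yv w j : (w.+1 < l)%N ->
  swapv w (yv j) = yv (if j == w then w.+1 else if j == w.+1 then w else j).
Proof. by move=> lw; rewrite /yv rmorphB rmorph1 /= swapv_xv. Qed.

Lemma swapvK w : (w.+1 < l)%N -> involutive (swapv w).
Proof. by move=> lw p; rewrite (swapvE lw) -msymMm tperm2 msym1m. Qed.

Variable k : nat.
Definition kphi : mpoly l rat -> Sym := keval [ffun=> k%:Z].
HB.instance Definition _ := GRing.Linear.copy kphi kphi.

Lemma kphiX m : kphi 'X_[m] = \prod_(i < l) kk i (k%:Z - (m i)%:Z).
Proof. by rewrite /kphi kevalX /kmon /kprod; apply: eq_bigr => i _; rewrite !ffunE. Qed.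

(** The factor [yv w.+1] turns [k^(w+1)] into [k^(w)], after which the positions
[w] and [w.+1] play the same role. *)
Lemma kphi_swap w h : (w.+1 < l)%N -> kphi (yv w.+1 * h) = kphi (yv w.+1 * swapv w h).
Proof.
move=> lw; suff mono m : kphi (yv w.+1 * 'X_[m]) = kphi (yv w.+1 * swapv w 'X_[m]).
  elim/mpolyind: h => [|a m p _ _ IH]; first by rewrite [swapv _ 0]linear0.
  by rewrite [swapv _ _]linearP !mulrDr -!scalerAr !linearP /= IH mono.
rewrite (swapvE lw) msymX; set i := Ordinal (ltnW lw); set j := Ordinal lw.
have nij : j != i by rewrite -val_eqE /= eqn_leq ltnn.
have key (m' : multinom l) : kphi (yv w.+1 * 'X_[m']) =
  (\prod_(o < l | (o != i) && (o != j)) kk o (k%:Z - (m' o)%:Z)) *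
  (kk w (k%:Z - (m' i)%:Z) * kk w (k%:Z - (m' j)%:Z)).
  rewrite /yv -[w.+1]/(val j) xv_ord mulrBl mul1r -mpolyXD linearB /= !kphiX.
  rewrite (bigD1 i) //= (bigD1 j) //= [in X in _ - X](bigD1 i) //= [in X in _ - X](bigD1 j) //=.
  rewrite (mnmDE i) (mnmDE j) !mnm1E eqxx (negPf nij) add0n.
  have -> : \prod_(o < l | (o != i) && (o != j)) kk o (k%:Z - ((U_(j) + m')%MM o)%:Z) =
            \prod_(o < l | (o != i) && (o != j)) kk o (k%:Z - (m' o)%:Z).
    by apply: eq_bigr => o /andP[_ no]; rewrite mnmDE mnm1E eq_sym (negPf no).
  rewrite -[in RHS](kkS_diff w (_ - (m' j)%:Z)).
  have -> : k%:Z - (1 + m' j)%N%:Z = k%:Z - (m' j)%:Z - 1 by lia.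
  set P := \prod_(_ | _) _; move: (kk w.+1 _) (kk w.+1 _) (kk w _) => a b c.
  by ring.
rewrite !key; set m' := [multinom _ | _ < _].
have m'E o : m' o = m (tperm i j o) by rewrite mnmE tpermV.
have -> : \prod_(o < l | (o != i) && (o != j)) kk o (k%:Z - (m' o)%:Z) =
          \prod_(o < l | (o != i) && (o != j)) kk o (k%:Z - (m o)%:Z).
  by apply: eq_bigr => o /andP[oi oj]; rewrite m'E tpermD // eq_sym.
by rewrite !m'E tpermL tpermR [X in _ = _ * X]mulrC.
Qed.

(** A subscript has become negative. *)
Lemma kphi_xk z h : kphi (xv z ^+ k.+1 * h) = 0.
Proof.
have [lz|lz] := ltnP z l; last by rewrite xv0 // expr0n mul0r linear0.
have -> : xv z = 'X_(Ordinal lz) by rewrite -xv_ord.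
suff mono m : kphi ('X_(Ordinal lz) ^+ k.+1 * 'X_[m]) = 0.
  elim/mpolyind: h => [|a m p _ _ IH]; first by rewrite mulr0 linear0.
  by rewrite mulrDr -scalerAr linearP /= IH mono scaler0 addr0.
rewrite mpolyXn -mpolyXD kphiX (bigD1 (Ordinal lz)) //= (mnmDE (Ordinal lz)).
rewrite mulmnE mnm1E eqxx mul1n.
have -> : k%:Z - (k.+1 + m (Ordinal lz))%N%:Z = Negz (m (Ordinal lz)) by lia.
by rewrite mul0r.
Qed.

End Evaluation.

(** * Rows as polynomials *)

Lemma eq_oppr0 (V : lmodType rat) (v : V) : v = - v -> v = 0.
Proof.
move=> ev; have : v + v = 0 by rewrite {2}ev subrr.
rewrite -mulr2n -scaler_nat => /eqP; rewrite scaler_eq0 pnatr_eq0 /=.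
by move/eqP.
Qed.

Definition swap_idx (w j : nat) := if j == w then w.+1 else if j == w.+1 then w else j.

Lemma swap_idx_l w : swap_idx w w = w.+1.
Proof. by rewrite /swap_idx eqxx. Qed.

Lemma swap_idx_r w : swap_idx w w.+1 = w.
Proof. by rewrite /swap_idx eqxx eqn_leq ltnn. Qed.

Lemma swap_idx_id w j : j != w -> j != w.+1 -> swap_idx w j = j.
Proof. by rewrite /swap_idx => /negPf -> /negPf ->. Qed.

Lemma swap_idxK w : involutive (swap_idx w).
Proof.
by move=> j; rewrite /swap_idx; case: (eqVneq j w) => [->|jw];
  [|case: (eqVneq j w.+1) => [->|jw1]]; do ?[case: eqP => ? //]; lia.
Qed.

Lemma prod_swap_idx (R : comNzRingType) w a b (F : nat -> R) :
  w.+1 != a -> w.+1 != b ->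
  \prod_(a <= j < b) F (swap_idx w j) = \prod_(a <= j < b) F j.
Proof.
move=> wa wb; rewrite -(big_map (swap_idx w) xpredT F); apply: perm_big; apply: uniq_perm.
- by rewrite map_inj_uniq ?iota_uniq //; exact: inv_inj (@swap_idxK w).
- exact: iota_uniq.
move=> j; rewrite -[j in LHS](swap_idxK w) mem_map; last exact: inv_inj (@swap_idxK w).
rewrite !mem_index_iota /swap_idx; case: (eqVneq j w) => [->|jw]; first by lia.
by case: (eqVneq j w.+1) => [->|jw1]; lia.
Qed.

(** Row [z] of defect [n]: its non-roots are the columns [z < j <= z + n], and each
non-root [(z, j)] contributes [1 - R_zj], that is [(x_z - x_j) / x_z], the
powers of [x_z] being absorbed in the exponent [k] of [kphi].  A root [(z, j)]
contributes [1 - L_j]. *)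
HB.lock Definition krow (l z n : nat) : mpoly l rat :=
  \prod_(z.+1 <= j < (z + n).+1) (xv l z - xv l j) *
  \prod_((z + n).+1 <= j < l) yv l j.

(** The row with its first root column left undecided: multiplying it by [yv] of
that column, or by [x_z - x] of that column, makes it a root or a non-root. *)
HB.lock Definition krow_open (l z n : nat) : mpoly l rat :=
  \prod_(z.+1 <= j < (z + n).+1) (xv l z - xv l j) *
  \prod_((z + n).+2 <= j < l) yv l j.

(** The part of the product of two consecutive rows of equal defect that is
symmetric under the exchange of their variables. *)
HB.lock Definition krow2 (l z n : nat) : mpoly l rat :=
  \prod_(z.+2 <= j < (z + n).+1) (xv l z - xv l j) *
  \prod_(z.+2 <= j < (z + n).+1) (xv l z.+1 - xv l j) *
  (\prod_((z + n).+1 <= j < l) yv l j * \prod_((z + n).+2 <= j < l) yv l j).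

Section Rows.
Variable l : nat.
Local Notation x := (@xv l).
Local Notation y := (@yv l).
Local Notation krow := (@krow l).
Local Notation krow_open := (@krow_open l).
Local Notation krow2 := (@krow2 l).

Lemma swapv_x w j : (w.+1 < l)%N -> swapv w (x j) = x (swap_idx w j).
Proof. exact: swapv_xv. Qed.

Lemma swapv_y w j : (w.+1 < l)%N -> swapv w (y j) = y (swap_idx w j).
Proof. exact: swapv_yv. Qed.

Lemma swapv_x_id w j : (w.+1 < l)%N -> j != w -> j != w.+1 -> swapv w (x j) = x j.
Proof. exact: swapv_xv_id. Qed.

Lemma swapv_y_id w j : (w.+1 < l)%N -> j != w -> j != w.+1 -> swapv w (y j) = y j.
Proof. by move=> lw jw jw1; rewrite swapv_y // /swap_idx (negPf jw) (negPf jw1). Qed.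

Lemma swapv_prod_y w a : (w.+1 < l)%N -> w.+1 != a ->
  swapv w (\prod_(a <= j < l) y j) = \prod_(a <= j < l) y j.
Proof.
move=> lw wa; rewrite rmorph_prod -[RHS](@prod_swap_idx _ w) //; last by rewrite neq_ltn lw.
by apply: eq_bigr => j _; exact: swapv_y.
Qed.

Lemma swapv_prod_x w p a b : (w.+1 < l)%N -> w.+1 != a -> w.+1 != b -> swapv w p = p ->
  swapv w (\prod_(a <= j < b) (p - x j)) = \prod_(a <= j < b) (p - x j).
Proof.
move=> lw wa wb wp; rewrite rmorph_prod -[RHS](@prod_swap_idx _ w) //.
by apply: eq_bigr => j _; rewrite rmorphB /= wp swapv_x.
Qed.

Lemma krow_open_y z n : krow z n = y (z + n).+1 * krow_open z n.
Proof.
rewrite krow.unlock krow_open.unlock; have [le|lt] := ltnP (z + n).+1 l.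
  by rewrite (big_ltn le) mulrCA.
rewrite yv1 // mul1r [\prod_((z + n).+1 <= j < l) _]big_geq //.
by rewrite [\prod_((z + n).+2 <= j < l) _]big_geq //; lia.
Qed.

Lemma krowS_open z n : krow z n.+1 = (x z - x (z + n).+1) * krow_open z n.
Proof.
rewrite krow.unlock krow_open.unlock addnS big_nat_recr /=; last by lia.
by rewrite -mulrA mulrCA.
Qed.

(** The weight of row [z] drops by one while its first root is removed: this is
what makes [yv z] act as the difference of two closed rows. *)
Lemma y_krow_open z n : y z * krow_open z n = krow z n - krow z n.+1.
Proof. by rewrite krow_open_y krowS_open -mulrBl /yv; congr (_ * _); ring. Qed.

(** Columns [w] and [w.+1] of the row have the same status unless the roots begin
exactly at column [w.+1]. *)
Lemma swapv_krow w z n : (w.+1 < l)%N -> z != w -> z != w.+1 -> w != (z + n)%N ->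
  swapv w (krow z n) = krow z n.
Proof.
move=> lw zw zw1 wn; rewrite krow.unlock.
rewrite rmorphM /= ?swapv_prod_y ?swapv_prod_x ?swapv_x_id ?eqSS //.
by rewrite eq_sym.
Qed.

Lemma swapv_krow_open w z n : (w.+1 < l)%N -> z != w -> z != w.+1 -> w != (z + n)%N ->
  w != (z + n).+1 -> swapv w (krow_open z n) = krow_open z n.
Proof.
move=> lw zw zw1 wn wn1.
rewrite krow_open.unlock rmorphM /= ?swapv_prod_y ?swapv_prod_x ?swapv_x_id ?eqSS //.
by rewrite eq_sym.
Qed.

Lemma krow_krow z n : (0 < n)%N ->
  krow z n * krow z.+1 n = (x z - x z.+1) * (x z.+1 - x (z + n).+1) * krow2 z n.
Proof.
move=> n0; rewrite krow.unlock krow2.unlock addSn big_ltn; last by lia.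
rewrite [\prod_(z.+2 <= j < (z + n).+2) _]big_nat_recr /=; last by lia.
by ring.
Qed.

Lemma swapv_krow2 z n : (z.+1 < l)%N -> (0 < n)%N -> swapv z (krow2 z n) = krow2 z n.
Proof.
move=> lz n0; rewrite krow2.unlock !rmorphM /= !swapv_prod_y //; try lia.
congr (_ * _); rewrite mulrC !rmorph_prod; congr (_ * _).
  apply: eq_big_nat => j /andP[zj _]; rewrite rmorphB /= !swapv_x // /swap_idx eqxx.
  by rewrite eqn_leq ltnn /= !ifN //; lia.
apply: eq_big_nat => j /andP[zj _]; rewrite rmorphB /= !swapv_x // /swap_idx eqxx.
by rewrite !ifN //; lia.
Qed.

Lemma swapv_krow2_below w z n : (w.+1 < z)%N -> (w.+1 < l)%N ->
  swapv w (krow2 z n) = krow2 z n.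
Proof.
by move=> wz lw; rewrite krow2.unlock !rmorphM /= !swapv_prod_y ?swapv_prod_x ?swapv_x_id //; lia.
Qed.

Lemma krow2_split z n : ((z + n).+2 < l)%N -> krow2 z n = y (z + n).+2 *
  (\prod_(z.+2 <= j < (z + n).+1) (x z - x j) *
   \prod_(z.+2 <= j < (z + n).+1) (x z.+1 - x j) *
   (y (z + n).+1 * y (z + n).+2) *
   (\prod_((z + n).+3 <= j < l) y j * \prod_((z + n).+3 <= j < l) y j)).
Proof.
move=> lt; rewrite krow2.unlock [\prod_((z + n).+1 <= j < l) _]big_ltn; last by lia.
by rewrite ![\prod_((z + n).+2 <= j < l) _]big_ltn //; ring.
Qed.

(** Both rows have a root in column [(z + n).+2], but only the first one in the
column before, so that one factor [yv] of the former is left over. *)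
Lemma krow2_at_next z n : ((z + n).+2 < l)%N -> (0 < n)%N ->
  exists2 q, swapv (z + n).+1 q = q & krow2 z n = y (z + n).+2 * q.
Proof.
move=> lt n0; eexists; last exact: krow2_split.
rewrite !rmorphM /= ?swapv_prod_y ?swapv_prod_x ?swapv_x_id //; try lia.
rewrite !swapv_y // swap_idx_l swap_idx_r; congr (_ * _ * _).
by rewrite mulrC.

Qed.

End Rows.

(** * Moving along a chain of rows *)

Section Chain.
Variables (k l : nat) (n : nat -> nat).
Hypothesis n_mono : forall i, (n i <= n i.+1)%N.
Hypothesis n_top : forall i, (l <= i)%N -> n i = k.
Local Notation x := (@xv l).
Local Notation y := (@yv l).
Local Notation phi := (@kphi l k).
Local Notation krow_at i := (krow l i (n i)).

(** The first column with a root in row [i], which is also the next row of the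
chain through [i]. *)
Definition nxt (i : nat) : nat := (i + n i).+1.

Lemma n_homo i j : (i <= j)%N -> (n i <= n j)%N.
Proof. by move=> ij; apply: (@homo_leq _ n leq) => //; exact: leq_trans. Qed.

Lemma nxt_lt i j : (i < j)%N -> (nxt i < nxt j)%N.
Proof. by move=> ij; rewrite /nxt ltnS; have := n_homo (ltnW ij); lia. Qed.

(** Property of the product of the rows before [z]: columns [w] and [w.+1] have the
same status there, unless some of these rows has its first root in column [w.+1]. *)
Definition inv_above z (h : mpoly l rat) := forall w, (z < w)%N -> (w.+1 < l)%N ->
  (forall i, (i < z)%N -> nxt i != w.+1) -> swapv w h = h.

Definition inv_below z (a : mpoly l rat) :=
  forall w, (w.+1 < z)%N -> (w.+1 < l)%N -> swapv w a = a.

(** What is known about the product [h] of the rows before [z] when the chain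
reaches [z]: multiplied by anything antisymmetric in the variables of rows [z]
and [z.+1], it has a zero image.  The factor must be unaffected by the
exchanges before [z], which are used to average it. *)
Definition kills_anti z (h : mpoly l rat) :=
  forall a, swapv z a = - a -> inv_below z a -> phi (h * a) = 0.

Lemma kphi_anti w h : (w.+1 < l)%N -> swapv w h = - h -> phi (y w.+1 * h) = 0.
Proof.
by move=> lw ha; apply: eq_oppr0; rewrite {1}kphi_swap // ha mulrN linearN.
Qed.

Lemma swapv_krow_at w i : (w.+1 < l)%N -> i != w -> i != w.+1 -> nxt i != w.+1 ->
  swapv w (krow_at i) = krow_at i.
Proof. by move=> lw iw iw1 nw; apply: swapv_krow => //; rewrite eq_sym. Qed.

Lemma swapv_krows w a b : (w.+1 < l)%N ->
  (forall i, (a <= i < b)%N -> [&& i != w, i != w.+1 & nxt i != w.+1]) ->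
  swapv w (\prod_(a <= i < b) krow_at i) = \prod_(a <= i < b) krow_at i.
Proof.
move=> lw ok; rewrite rmorph_prod; apply: eq_big_nat => i /ok /and3P[*].
exact: swapv_krow_at.
Qed.

Lemma inv_above_krows z z2 h : (z <= z2)%N -> inv_above z h ->
  inv_above z2 (h * \prod_(z <= i < z2) krow_at i).
Proof.
move=> zz hz w zw lw ni; rewrite rmorphM /= hz ?swapv_krows //; try lia.
- by move=> i /andP[_ iz]; rewrite ni //; lia.
- by move=> i iz; apply: ni; lia.
Qed.

Lemma inv_above_good z h : inv_above z h ->
  inv_above (nxt z) (h * (y z * krow_open l z (n z) * \prod_(z.+1 <= i < nxt z) krow_at i)).
Proof.
have zz : (z < nxt z)%N by rewrite /nxt; lia.
move=> hz w zw lw ni; rewrite !rmorphM /= swapv_y_id ?hz //; try lia; last first.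
  by move=> i iz; apply: ni; lia.
rewrite swapv_krows // => [|i /andP[_ iz]]; last by rewrite ni //; lia.
by rewrite swapv_krow_open //; move: zw; rewrite /nxt; lia.
Qed.

(** Once row [z] is opened, its root in column [nxt z] is gone while the one in the
next column remains; the product is then [yv (nxt z).+1] times something
symmetric in both columns. *)
Lemma kills_anti_good z h : inv_above z h -> (n z < n z.+1)%N ->
  ((nxt z).+1 < l)%N ->
  kills_anti (nxt z) (h * (y z * krow_open l z (n z) * \prod_(z.+1 <= i < nxt z) krow_at i)).
Proof.
move=> hz good lz a aa _; have zz : (z < nxt z)%N by rewrite /nxt; lia.
have zn i : (z < i)%N -> ((nxt z).+1 < nxt i)%N.
  by move=> iz; move: (n_homo iz) good; rewrite /nxt; lia.
have nz i : (i < z)%N -> (nxt i < nxt z)%N by exact: nxt_lt.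
pose q := \prod_(z.+1 <= j < nxt z) (x z - x j) * \prod_((nxt z).+2 <= j < l) y j.
have -> : krow_open l z (n z) = y (nxt z).+1 * q.
  by rewrite krow_open.unlock /q -/(nxt z) (big_ltn lz) mulrCA.
have -> : h * (y z * (y (nxt z).+1 * q) * \prod_(z.+1 <= i < nxt z) krow_at i) * a =
  y (nxt z).+1 * (h * y z * q * (\prod_(z.+1 <= i < nxt z) krow_at i) * a) by ring.
apply: kphi_anti => //; rewrite !rmorphM /= aa mulrN hz //; last first.
  by move=> i /nz; lia.
rewrite ?swapv_prod_y ?swapv_prod_x ?swapv_y_id ?swapv_x_id ?swapv_krows //; try lia.
by move=> i /andP[/zn zi iz]; lia.
Qed.

(** Two consecutive rows of equal defect differ by the exchange of their variables,
except for the non-root between them, which is antisymmetric, and for the first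
root column, which the factor [x z - x (nxt z)] evens out. *)
Lemma krows_anti z : (z.+1 < l)%N -> n z = n z.+1 -> (0 < n z)%N ->
  let a := (x z - x (nxt z)) * \prod_(z <= i < l) krow_at i in
  swapv z a = - a /\ inv_below z a.
Proof.
move=> lz bad n0 a; have zz : (z.+1 < nxt z)%N by rewrite /nxt; lia.
have nz i : (z.+1 < i)%N -> (nxt z.+1 < nxt i)%N by exact: nxt_lt.
have aE : a = (x z - x (nxt z)) * (x z.+1 - x (nxt z)) * (x z - x z.+1) *
   krow2 l z (n z) * \prod_(z.+2 <= i < l) krow_at i.
  rewrite /a (big_ltn (ltnW lz)) (big_ltn lz) [krow_at z * _]mulrA -bad krow_krow //.
  by rewrite -/(nxt z); ring.
split=> [|w wz lw].
  rewrite aE !rmorphM /= swapv_krow2 // swapv_krows //; last first.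
    by move=> i /andP[zi il]; move: (nz _ zi); rewrite /nxt; lia.
  rewrite !rmorphB /= !(@swapv_x l z) // swap_idx_l swap_idx_r swap_idx_id; try lia.
  by ring.
rewrite /a rmorphM rmorphB /= !swapv_x_id ?swapv_krows //; try lia.
by move=> i /andP[zi il]; rewrite /nxt; lia.
Qed.

(** The rows [z] and [z.+1] do not have the same columns of roots, which spoils the
symmetry needed at [nxt z].  Averaging over the exchange of their variables,
which is allowed by the hypothesis at [z], removes the offending factor
[x z.+1 - x (nxt z)]. *)
Lemma kills_anti_bad z h : (z.+1 < l)%N -> n z = n z.+1 -> (0 < n z)%N ->
  inv_above z h -> kills_anti z h -> ((nxt z).+1 < l)%N ->
  kills_anti (nxt z) (h * \prod_(z <= i < nxt z) krow_at i).
Proof.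
move=> lz bad n0 hz kz lz2 a aa la; have zz : (z.+1 < nxt z)%N by rewrite /nxt; lia.
have nz i : (z.+1 < i)%N -> ((nxt z).+1 < nxt i)%N.
  by move=> zi; have := nxt_lt zi; rewrite /nxt -bad; lia.
have nz' i : (i < z)%N -> (nxt i < nxt z)%N by exact: nxt_lt.
have z_ne : (z != nxt z) && (z != (nxt z).+1) by lia.
have z1_ne : (z.+1 != nxt z) && (z.+1 != (nxt z).+1) by lia.
have swh : swapv (nxt z) h = h.
  by apply: hz => [||i /nz']; [exact: ltnW| |move=> lt; rewrite neq_ltn ltnS ltnW].
pose M := \prod_(z.+2 <= i < nxt z) krow_at i.
have swM' : swapv (nxt z) M = M.
  by apply: swapv_krows => // i /andP[zi iz]; move: (nz _ zi); lia.
pose b := \prod_(z <= i < nxt z) krow_at i * a.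
have bE : b = (x z - x z.+1) * (x z.+1 - x (nxt z)) * krow2 l z (n z) * M * a.
  rewrite /b (big_ltn (ltnW zz)) (big_ltn zz) [krow_at z * _]mulrA -bad krow_krow //.
have swa : swapv z a = a by apply: la.
have swM : swapv z M = M.
  by apply: swapv_krows => // i /andP[zi _]; move: (nz _ zi); lia.
have sbE : swapv z b =
    (x z.+1 - x z) * (x z - x (nxt z)) * krow2 l z (n z) * M * a.
  rewrite bE !rmorphM /= swa swM swapv_krow2 // !rmorphB /= !(@swapv_x l z) //.
  by rewrite swap_idx_l swap_idx_r swap_idx_id //; lia.
have [q swq qE] := @krow2_at_next l z (n z) lz2 n0.
(* This uses the hypothesis at z, for the antisymmetric b - swapv z b. *)
have phib : phi (h * b) = phi (h * swapv z b).
  apply/eqP; rewrite -subr_eq0 -linearB -mulrBr; apply/eqP; apply: kz.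
    by rewrite rmorphB /= swapvK // opprB.
  move=> w wz lw; rewrite rmorphB /=.
  have swb : swapv w b = b.
    rewrite /b rmorphM /= la ?swapv_krows //; try lia.
    by move=> i /andP[zi _]; rewrite /nxt; lia.
  have sws : swapv w (swapv z b) = swapv z b.
    rewrite sbE !rmorphM !rmorphB /= swapv_krow2_below // la ?swapv_x_id //; try lia.
    by rewrite swapv_krows //; move=> i /andP[zi _]; rewrite /nxt; lia.
  by rewrite swb sws.
have : phi (h * b) + phi (h * b) = 0.
  rewrite {1}phib -linearD sbE bE qE.
  pose D := x z - x z.+1.
  have swD : swapv (nxt z) D = D.
    by case/andP: z_ne => *; case/andP: z1_ne => *; rewrite /D rmorphB /= !swapv_x_id.
  have [g swg ->] : exists2 g, swapv (nxt z) g = g &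
    h * ((x z.+1 - x z) * (x z - x (nxt z)) * (y (z + n z).+2 * q) * M * a) +
    h * ((x z - x z.+1) * (x z.+1 - x (nxt z)) * (y (z + n z).+2 * q) * M * a) =
    y (nxt z).+1 * - (g * a).
    exists (D * D * h * q * M); last by rewrite /nxt /D; ring.
    have swq' : swapv (nxt z) q = q by [].
    by rewrite 4!rmorphM /= swD swh swq' swM'.
  have swga : swapv (nxt z) (g * a) = - (g * a) by rewrite rmorphM /= swg aa mulrN.
  by rewrite mulrN linearN /= (kphi_anti lz2 swga) oppr0.
by rewrite -mulrA -/b; move/(canRL (addrK _)); rewrite sub0r => /eq_oppr0.
Qed.

Definition krow_sel (G : pred nat) i : mpoly l rat :=
  if G i then y i * krow_open l i (n i) else krow_at i.

(** [G] is the set of the rows of the chain starting at [z] that are strictly longer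
than the next row.  It depends only on the defects, not on [h]. *)
Lemma chain z : exists G : pred nat,
  (forall i, G i -> [&& z <= i, i < l & n i < n i.+1])%N /\
  forall h, inv_above z h ->
    ((z.+1 < l)%N -> n z = n z.+1 -> kills_anti z h /\ (0 < n z)%N) ->
    phi (y z * (h * \prod_(z <= i < l) krow_at i)) =
    phi (h * \prod_(z <= i < l) krow_sel G i).
Proof.
have split_at a b c (F : nat -> mpoly l rat) : (a <= b)%N -> (b <= c)%N ->
    \prod_(a <= i < c) F i = (\prod_(a <= i < b) F i) * \prod_(b <= i < c) F i.
  by move=> ab bc; exact: big_cat_nat.
have first_at a (F : nat -> mpoly l rat) : (a < l)%N ->
    \prod_(a <= i < l) F i = F a * \prod_(a.+1 <= i < l) F i.
  by move=> al; exact: big_ltn.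
have [d] := ubnP (l - z); elim: d z => // d IH z; rewrite ltnS => lzd.
have sel0 a : \prod_(a <= i < l) krow_sel pred0 i = \prod_(a <= i < l) krow_at i by [].
have [lz|zl] := leqP l z.
  exists pred0; split; first by [].
  by move=> h _ _; rewrite (yv1 lz) mul1r -sel0.
have zz : (z < nxt z)%N by rewrite /nxt; lia.
have lt_d : (l - nxt z < d)%N by lia.
have [G [GP GE]] := IH _ lt_d.
have Gle i : G i -> (nxt z <= i)%N by move=> /GP/and3P[].
have selE a b : (b <= nxt z)%N ->
    \prod_(a <= i < b) krow_sel G i = \prod_(a <= i < b) krow_at i.
  move=> bz; apply: eq_big_nat => i /andP[_ ib]; rewrite /krow_sel ifN //.
  by apply/negP => /Gle; lia.
have n0 : (0 < n z)%N -> (0 < n (nxt z))%N.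
  by move=> n0; apply: leq_trans n0 _; apply: n_homo; exact: ltnW.
have [good|bad] : (n z < n z.+1)%N \/ n z = n z.+1.
- move: (n_mono z); rewrite leq_eqVlt => /orP[/eqP bad|good]; [right|left]; assumption.
- exists (fun i => (i == z) || G i); split=> [i /orP[/eqP ->|/GP/and3P[zi il gi]]|h hz _].
  + by rewrite leqnn zl good.
  + by rewrite il gi (leq_trans (ltnW zz) zi).
  have selz : krow_sel (fun i => (i == z) || G i) z = y z * krow_open l z (n z).
    by rewrite /krow_sel eqxx.
  have sel' a : (z < a)%N -> \prod_(a <= i < l) krow_sel (fun i => (i == z) || G i) i =
      \prod_(a <= i < l) krow_sel G i.
    move=> za; apply: eq_big_nat => i /andP[ai _]; rewrite /krow_sel.
    by rewrite (_ : i == z = false) //; apply/negP => /eqP; lia.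
  rewrite (first_at _ (fun i => krow_at i) zl) (first_at _ (krow_sel _) zl).
  rewrite selz (sel' _ (ltnSn z)) krow_open_y -/(nxt z).
  have [lz2|z2l] := leqP l (nxt z).
    by rewrite (selE _ _ lz2) (yv1 lz2) mul1r mulrCA [y z * (_ * _)]mulrA.
  rewrite (split_at z.+1 _ _ (fun i => krow_at i) zz (ltnW z2l)).
  rewrite (split_at z.+1 _ _ (krow_sel G) zz (ltnW z2l)).
  rewrite (selE _ _ (leqnn _)).
  have arrange (a p b r A B : mpoly l rat) :
      a * (p * (b * r * (A * B))) = b * (p * (a * r * A) * B) by ring.
  have arrange' (a p r A B : mpoly l rat) :
      p * (a * r * (A * B)) = p * (a * r * A) * B by ring.
  rewrite arrange arrange' GE; [reflexivity | exact: inv_above_good |].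
  move=> lz2 bad2; split; first exact: kills_anti_good.
  have : (n z.+1 <= n (nxt z))%N by apply: n_homo.
  by apply: leq_trans; apply: leq_ltn_trans good.
- exists G; split=> [i /GP/and3P[zi -> ->]|h hz kz].
    by rewrite (leq_trans (ltnW zz) zi).
  suff yz : phi (y z * (h * \prod_(z <= i < l) krow_at i)) =
            phi (y (nxt z) * (h * \prod_(z <= i < l) krow_at i)).
    have [lz2|z2l] := leqP l (nxt z).
      by rewrite yz (yv1 lz2) mul1r -(selE z l lz2); reflexivity.
    rewrite yz (split_at z _ _ (fun i => krow_at i) (ltnW zz) (ltnW z2l)).
    rewrite (split_at z _ _ (krow_sel G) (ltnW zz) (ltnW z2l)) (selE _ _ (leqnn _)).
    have assoc (A B B' : mpoly l rat) :
        phi (y (nxt z) * (h * A * B)) = phi (h * A * B') ->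
        phi (y (nxt z) * (h * (A * B))) = phi (h * (A * B')) by rewrite !mulrA.
    apply: assoc. apply: GE. exact: (inv_above_krows (ltnW zz) hz).
    move=> lz2 bad2; have lz : (z.+1 < l)%N by lia.
    have [kh nz0] := kz lz bad; split; last exact: n0.
    exact: kills_anti_bad.
  apply/eqP; rewrite -subr_eq0 -linearB -mulrBl /=.
  have -> : y z - y (nxt z) = - (x z - x (nxt z)) by rewrite /yv; ring.
  rewrite mulNr linearN oppr_eq0 /= mulrCA.
  have [lz|zl1] := ltnP z.+1 l.
    have [kh nz0] := kz lz bad; have [an bl] := krows_anti lz bad nz0.
    by rewrite kh.
  have nzk : n z = k by rewrite bad n_top.
  rewrite (@xv0 l (nxt z)) ?subr0; last by lia.
  rewrite big_ltn // [\prod_(z.+1 <= i < l) _]big_geq // mulr1 krow.unlock nzk.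
  rewrite [\prod_(_ <= j < l) _]big_geq ?mulr1; last by lia.
  have -> : \prod_(z.+1 <= j < (z + k).+1) (x z - x j) = x z ^+ k.
    rewrite -[k in RHS](_ : ((z + k).+1 - z.+1)%N = k); last by lia.
    rewrite -prodr_const_nat; apply: eq_big_nat => j /andP[zj _].
    by rewrite (@xv0 l j) ?subr0 //; lia.
  by rewrite -exprS mulrC kphi_xk.
Qed.

End Chain.

(** * Alternating expansions *)

Section Expansion.
Variables (k l : nat).
Local Notation x := (@xv l).
Local Notation y := (@yv l).
Local Notation phi := (@kphi l k).

(** Partitions are handled through their defects, which increase along the rows and
are at most [k]; reading a sequence beyond its end with default [k] amounts to
adding parts equal to zero. *)
Definition defects (s : seq nat) : bool :=
  [&& size s == l, sorted leq s & all (leq^~ k) s].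

Definition krows (s : seq nat) : mpoly l rat :=
  \prod_(0 <= i < l) krow l i (nth k s i).

Lemma defects_size s : defects s -> size s = l.
Proof. by case/and3P => /eqP. Qed.

Lemma defects_le s i : defects s -> (nth k s i <= k)%N.
Proof.
move=> ds; have [lt|ge] := ltnP i (size s); last by rewrite nth_default.
by case/and3P: ds => _ _ /allP; apply; exact: mem_nth.
Qed.

Lemma defects_mono s i : defects s -> (nth k s i <= nth k s i.+1)%N.
Proof.
move=> ds; have [lt|ge] := ltnP i.+1 (size s); last first.
  by rewrite [nth k s i.+1]nth_default // defects_le.
by case/and3P: ds => _ /(sortedP k)/(_ _ lt).
Qed.

Lemma defects_top s i : defects s -> (l <= i)%N -> nth k s i = k.
Proof. by move=> ds li; rewrite nth_default // defects_size. Qed.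

Lemma defectsP s : size s = l ->
  (forall i, (i < l)%N -> (nth k s i <= nth k s i.+1)%N) -> defects s.
Proof.
move=> sz mono; have szl i : (l <= i)%N -> nth k s i = k by move=> ?; rewrite nth_default ?sz.
have lek d : (nth k s (l - d) <= k)%N.
  elim: d => [|d IH]; first by rewrite szl // subn0.
  have [ld|dl] := leqP l d; first by rewrite (_ : l - d.+1 = l - d)%N //; lia.
  by apply: leq_trans (mono _ _) _; [lia | rewrite subnSK].
apply/and3P; split; first by rewrite sz.
  by apply/(sortedP k) => i; rewrite sz => lt; apply: mono; exact: ltnW.
apply/(all_nthP k) => i; rewrite sz => il.
by have := lek (l - i)%N; rewrite subKn // ltnW.
Qed.

(** The rows before [t] are unchanged and the other ones may have been lowered. *)
Definition refines t s s' :=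
  [/\ defects s', forall i, (i < t)%N -> nth k s' i = nth k s i &
      forall i, (nth k s i <= nth k s' i)%N].

Definition free_from t (f : mpoly l rat) :=
  forall w, (t <= w)%N -> (w.+1 < l)%N -> swapv w f = f.

(** The expansion must hold with any further factor [f] in the variables before
[t], since the corresponding rows are to be treated later; the list of partitions
does not depend on [f].  Only the parity of [e] matters. *)
Definition expands t s e (V : mpoly l rat -> Sym) : Prop :=
  exists L : seq (seq nat), (forall s', s' \in L -> refines t s s') /\
  forall f, free_from t f ->
    V f = \sum_(s' <- L) (-1) ^+ (sumn s' + e) *: phi (f * krows s').

Lemma eq_expands t s e V W : (forall f, free_from t f -> V f = W f) ->
  expands t s e V -> expands t s e W.
Proof.
move=> eVW [L [LP LE]]; exists L; split; [exact: LP | move=> f ff].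
by rewrite -(eVW f ff) (LE f ff); reflexivity.
Qed.

Lemma expands0 t s e : expands t s e (fun=> 0).
Proof. by exists [::]; split; [by [] | move=> f _; rewrite big_nil; reflexivity]. Qed.

Lemma expandsD t s e V W : expands t s e V -> expands t s e W ->
  expands t s e (fun f => V f + W f).
Proof.
move=> [L [LP LE]] [L' [LP' LE']]; exists (L ++ L'); split=> [s'|f ff].
  by rewrite mem_cat => /orP[/LP|/LP'].
by rewrite big_cat (LE f ff) (LE' f ff); reflexivity.
Qed.

Lemma expands_sum t s e (I : Type) (r : seq I) (Q : pred I) V :
  (forall i, Q i -> expands t s e (V i)) ->
  expands t s e (fun f => \sum_(i <- r | Q i) V i f).
Proof.
move=> QV; elim: r => [|i r IH].
  by apply: eq_expands (expands0 t s e) => f _; rewrite big_nil; reflexivity.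
have [Qi|nQi] := boolP (Q i).
  by apply: eq_expands (expandsD (QV _ Qi) IH) => f _; rewrite big_cons Qi; reflexivity.
by apply: eq_expands IH => f _; rewrite big_cons (negPf nQi); reflexivity.
Qed.

Lemma expands_sign t s e e' V : expands t s e V ->
  expands t s (e + e') (fun f => (-1) ^+ e' *: V f).
Proof.
move=> [L [LP LE]]; exists L; split; [exact: LP | move=> f ff].
rewrite (LE f ff) scaler_sumr.
apply: eq_bigr => s' _; rewrite scalerA -exprD.
rewrite (_ : e' + (sumn s' + e) = sumn s' + (e + e'))%N; [reflexivity | lia].
Qed.

Lemma expands_parity t s e e' V : odd e = odd e' ->
  expands t s e V -> expands t s e' V.
Proof.
move=> ee [L [LP LE]]; exists L; split; [exact: LP | move=> f ff].
rewrite (LE f ff); apply: eq_bigr => s' _; rewrite -[(-1) ^+ (_ + e)]signr_odd oddD ee -oddD.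
by rewrite signr_odd; reflexivity.
Qed.

Lemma expands_single t s s' : refines t s s' ->
  expands t s (sumn s') (fun f => phi (f * krows s')).
Proof.
move=> rs; exists [:: s']; split=> [s''|f _]; first by rewrite inE => /eqP ->.
by rewrite big_seq1 addnn -signr_odd odd_double scale1r; reflexivity.
Qed.

Lemma refines_trans t t' s s' s'' : (t <= t')%N -> refines t' s s' ->
  refines t s' s'' -> refines t s s''.
Proof.
move=> tt' [d1 e1 l1] [d2 e2 l2]; split=> // i; last exact: leq_trans (l1 i) (l2 i).
by move=> it; rewrite e2 // e1 // (leq_trans it).
Qed.

Lemma expands_refine t t' s s' e V : (t <= t')%N -> refines t' s s' ->
  expands t s' e V -> expands t s e V.
Proof.
move=> tt' rs [L [LP LE]]; exists L; split; [|exact: LE].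
by move=> s'' /LP; exact: refines_trans rs.
Qed.

(** A row is lowered by raising its defect. *)
Definition bump_defects s (g : {ffun 'I_l -> bool}) : seq nat :=
  [seq (nth k s i + g i)%N | i : 'I_l].

Lemma nth_bump s g (i : 'I_l) : nth k (bump_defects s g) i = (nth k s i + g i)%N.
Proof. by rewrite (nth_map i) ?size_enum_ord // nth_ord_enum. Qed.

Lemma size_bump s g : size (bump_defects s g) = l.
Proof. by rewrite size_map size_enum_ord. Qed.

Lemma sumn_bump s g : size s = l ->
  sumn (bump_defects s g) = (sumn s + \sum_i g i)%N.
Proof.
move=> sz; rewrite /bump_defects sumnE big_map big_enum big_split /=; congr (_ + _)%N.
by rewrite sumnE (big_nth k) sz big_mkord.
Qed.

Lemma refines_bump t s (g : {ffun 'I_l -> bool}) : defects s ->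
  (forall i : 'I_l, g i -> (t <= i)%N && (nth k s i < nth k s i.+1)%N) ->
  refines t s (bump_defects s g).
Proof.
move=> ds gP; have nthb j : (l <= j)%N -> nth k (bump_defects s g) j = k.
  by move=> lj; rewrite nth_default // size_bump.
have le_nth j : (nth k s j <= nth k (bump_defects s g) j)%N.
  have [jl|lj] := ltnP j l; last by rewrite nthb // defects_le.
  by rewrite (nth_bump s g (Ordinal jl)) leq_addr.
split=> // [|i it]; last first.
  have [il|li] := ltnP i l; last by rewrite nthb // defects_top.
  rewrite (nth_bump s g (Ordinal il)); case: (boolP (g _)) => [/gP/andP[/= ti _]|_].
    by move: it; rewrite ltnNge ti.
  by rewrite addn0.
apply: defectsP => [|i il]; first exact: size_bump.
apply: leq_trans (le_nth _); rewrite (nth_bump s g (Ordinal il)) /=.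
case: (boolP (g _)) => [/gP/andP[_]|_]; first by rewrite addn1.
by rewrite addn0 defects_mono.
Qed.

(** Each open row is a difference of two closed rows; the term in which no row is
lowered is the one that is subtracted. *)
Lemma expands_krow_sel t s (G : pred nat) : defects s ->
  (forall i, G i -> [&& t <= i, i < l & nth k s i < nth k s i.+1])%N ->
  expands t s (sumn s).+1
    (fun f => phi (f * krows s) - phi (f * \prod_(0 <= i < l) krow_sel l (nth k s) G i)).
Proof.
move=> ds GP.
pose F (i : 'I_l) (b : bool) : mpoly l rat := if b then
  (if G i then - krow l i (nth k s i).+1 else 0) else krow l i (nth k s i).
have selF (i : 'I_l) : krow_sel l (nth k s) G i = \sum_b F i b.
  rewrite big_bool /F /krow_sel /=; case: (G i); last by rewrite add0r.
  by rewrite y_krow_open addrC.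
have prodF : \prod_(0 <= i < l) krow_sel l (nth k s) G i =
    \sum_(g : {ffun 'I_l -> bool}) \prod_i F i (g i).
  by rewrite big_mkord (eq_bigr _ (fun i _ => selF i)) bigA_distr_bigA.
have term (g : {ffun 'I_l -> bool}) : (forall i, g i -> G i) ->
    \prod_i F i (g i) = (-1) ^+ (\sum_i g i)%N * krows (bump_defects s g).
  move=> gG; rewrite /krows big_mkord.
  rewrite -prodrXr -big_split /=; apply: eq_bigr => i _; rewrite nth_bump /F.
  by case: ifP => [/gG ->|_]; rewrite ?addn1 ?addn0 ?expr1 ?mulN1r ?expr0 ?mul1r.
pose g0 : {ffun 'I_l -> bool} := [ffun=> false].
have F0 : \prod_i F i (g0 i) = krows s.
  by rewrite /krows big_mkord; apply: eq_bigr => i _; rewrite ffunE.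
apply: (@eq_expands _ _ _ (fun f => \sum_(g | g != g0) - phi (f * \prod_i F i (g i)))).
  move=> f _; rewrite prodF (bigD1 g0 isT) F0 mulrDr linearD opprD addNKr /=.
  by rewrite mulr_sumr [phi (\sum_(_ | _) _)]linear_sum sumrN; reflexivity.
apply: expands_sum => g _.
have [/forallP gG|/forallPn[i]] := boolP [forall i, g i ==> G i]; last first.
  rewrite negb_imply => /andP[gi nGi].
  apply: eq_expands (expands0 _ _ _) => f _.
  by rewrite (bigD1 i) //= /F gi (negPf nGi) mul0r mulr0 linear0 oppr0.
have {}gG i : g i -> G i by move: (gG i) => /implyP.
have rb : refines t s (bump_defects s g).
  by apply: refines_bump => // i /gG/GP/and3P[-> _ ->].
have odd_e : odd (sumn (bump_defects s g) + (\sum_i g i).+1) = odd (sumn s).+1.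
  by rewrite sumn_bump ?defects_size // addnS /= !oddD addbK.
apply: eq_expands (expands_parity odd_e (expands_sign _ (expands_single rb))).
move=> f _; rewrite (term _ gG) mulrCA -[in RHS]signr_odd -[in LHS]signr_odd /=.
case: (odd _) => /=.
  by rewrite !expr0 expr1 scale1r mulN1r linearN opprK; reflexivity.
by rewrite expr1 expr0 scaleN1r mul1r; reflexivity.
Qed.

Lemma expands_lower t s : defects s -> (t < l)%N ->
  (nth k s t < nth k s t.+1)%N ->
  expands t s (sumn s).+1 (fun f => phi (f * x t * krows s)).
Proof.
move=> ds tl good.
have mono i := defects_mono i ds; have top i := defects_top ds (i := i).
have [G [GP GE]] := chain mono top t.
apply: eq_expands (expands_krow_sel ds GP) => f ff.
pose h := f * \prod_(0 <= i < t) krow l i (nth k s i).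
have hE : phi (y t * (f * krows s)) = phi (f * \prod_(0 <= i < l) krow_sel l (nth k s) G i).
  have -> : f * krows s = h * \prod_(t <= i < l) krow l i (nth k s i).
    rewrite /krows /h (@big_cat_nat _ _ _ t 0%N l); [exact: mulrA | by [] | exact: ltnW].
  have -> : f * \prod_(0 <= i < l) krow_sel l (nth k s) G i =
            h * \prod_(t <= i < l) krow_sel l (nth k s) G i.
    rewrite /h (@big_cat_nat _ _ _ t 0%N l); [|by [] | exact: ltnW].
    rewrite mulrA; congr (f * _ * _); apply: eq_big_nat => i /andP[_ it].
    by rewrite /krow_sel ifN //; apply/negP => /GP/and3P[ti _ _]; lia.
  apply: GE => [w tw lw ni|_ bad]; last by move: good; rewrite bad ltnn.
  rewrite /h rmorphM /= ff ?(ltnW tw) // (@swapv_krows l (nth k s)) // => i /andP[_ it].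
  by rewrite ni //; lia.
rewrite -hE -linearB; congr (phi _); rewrite /yv; ring.
Qed.

(** The condition is void for the last row, which may be zero; lowering it then
gives zero. *)
Lemma expands_lower_strict t s : defects s -> (t < l)%N ->
  ((t.+1 < l)%N -> nth k s t < nth k s t.+1)%N ->
  expands t s (sumn s).+1 (fun f => phi (f * x t * krows s)).
Proof.
move=> ds tl good; have [lt|ge] := ltnP (nth k s t) (nth k s t.+1).
  exact: expands_lower.
have lt1 : t.+1 = l.
  by apply/eqP; rewrite eqn_leq tl leqNgt; apply/negP => /good; rewrite ltnNge ge.
apply: eq_expands (expands0 _ _ _) => f _.
have nk : nth k s t = k.
  apply/eqP; rewrite eqn_leq defects_le //=.
  by apply: leq_trans ge; rewrite defects_top // lt1.
have rowt : krow l t (nth k s t) = x t ^+ k.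
  rewrite nk krow.unlock [\prod_(_ <= j < l) _]big_geq ?mulr1; last by lia.
  rewrite -[k in RHS](_ : ((t + k).+1 - t.+1)%N = k); last by lia.
  rewrite -prodr_const_nat; apply: eq_big_nat => j /andP[zj _].
  by rewrite (@xv0 l j) ?subr0 // -lt1.
have -> : krows s = \prod_(0 <= i < t) krow l i (nth k s i) * krow l t (nth k s t).
  by rewrite /krows -[X in \prod_(0 <= i < X) _]lt1 big_nat_recr.
rewrite rowt; set p := \prod_(0 <= i < t) _.
have -> : f * x t * (p * x t ^+ k) = x t ^+ k.+1 * (f * p) by rewrite exprS; ring.
by rewrite kphi_xk.
Qed.

Definition xpart t (S : pred nat) : mpoly l rat :=
  \prod_(t <= i < l) (if S i then x i else 1).

Lemma xpartS t (S : pred nat) : (t < l)%N ->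
  xpart t S = (if S t then x t else 1) * xpart t.+1 S.
Proof. by move=> tl; rewrite /xpart big_ltn. Qed.

Lemma expands_xpart s (S : pred nat) t : defects s ->
  (forall i, (i.+1 < l)%N -> nth k s i < nth k s i.+1)%N -> (t <= l)%N ->
  expands t s (sumn s + \sum_(t <= i < l) S i)%N
    (fun f => phi (f * xpart t S * krows s)).
Proof.
move=> ds strict tl; have [d] := ubnP (l - t); elim: d t tl => // d IH t tl ltd.
have ref t' : refines t' s s by split.
have [lt|] := leqP l t.
  rewrite big_geq // addn0; apply: eq_expands (expands_single (ref t)) => f _.
  by rewrite /xpart (big_geq lt) mulr1; reflexivity.
move=> lt; have lt_d : (l - t.+1 < d)%N by lia.
have [L [LP LE]] := IH t.+1 lt lt_d.
have weaken f : free_from t f -> free_from t.+1 f by move=> ff w tw; apply: ff; exact: ltnW.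
have [St|nSt] := boolP (S t); last first.
  exists L; split=> [s' /LP [d1 e1 l1]|f /weaken ff].
    by split=> // i it; apply: e1; exact: ltnW.
  rewrite (xpartS S lt) (big_ltn lt) (negPf nSt) mul1r add0n (LE f ff); reflexivity.
rewrite big_ltn // St add1n.
apply: (@eq_expands _ _ _ (fun f => \sum_(s' <- L | s' \in L)
   (-1) ^+ (sumn s' + (sumn s + \sum_(t.+1 <= i < l) S i)) *: phi (f * x t * krows s'))).
  move=> f ff; have ffx : free_from t.+1 (f * x t).
    by move=> w tw lw; rewrite rmorphM /= ff ?(ltnW tw) // swapv_x_id //; lia.
  by rewrite (xpartS S lt) St (mulrA f) (LE _ ffx) [RHS]big_seq; reflexivity.
apply: expands_sum => s' /LP rs'; have [d1 e1 l1] := rs'.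
apply: (expands_refine (leqnSn t) rs').
have good' : ((t.+1 < l)%N -> nth k s' t < nth k s' t.+1)%N.
  by move=> /strict lt1; rewrite e1 //; apply: leq_trans lt1 (l1 _).
apply: expands_parity (expands_sign _ (expands_lower_strict d1 lt good')).
by rewrite addSn addnS addnA !oddS !oddD addbA addbb.
Qed.

End Expansion.

(** * The polynomial of a closed k-Schur Katalan function *)

Section KatalanEval.
Variable l : nat.
Implicit Types (c d gam : weight l) (p q : mpoly l rat).

Definition mnm_weight (m : multinom l) : weight l := [ffun i => (m i)%:Z].

Lemma keval_mulX c m p : keval c ('X_[m] * p) = keval (c - mnm_weight m) p.
Proof.
suff mono m' : keval c ('X_[m] * 'X_[m']) = keval (c - mnm_weight m) 'X_[m'].
  elim/mpolyind: p => [|a m' p _ _ IH]; first by rewrite mulr0 !linear0.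
  by rewrite mulrDr -scalerAr !linearP /= IH mono.
rewrite -mpolyXD !kevalX /kmon; congr (kprod _).
by apply/ffunP => i; rewrite !ffunE mnmDE PoszD opprD addrA.
Qed.

Lemma mnm_weightU (i : 'I_l) : mnm_weight U_(i) = eps i.
Proof. by apply/ffunP => j; rewrite !ffunE mnm1E eq_sym; case: eqP. Qed.

Lemma keval_mulU c i p : keval c ('X_i * p) = keval (c - eps i) p.
Proof. by rewrite keval_mulX mnm_weightU. Qed.

(** Here [1 - R_ij] is [x_i - x_j] after a shift of the [i]-th subscript. *)
Lemma foldr_one_minus_R (ps : seq ('I_l * 'I_l)) gam :
  foldr (@one_minus_R l) (@kprod l) ps gam =
  keval (gam + \sum_(ij <- ps) eps ij.1) (\prod_(ij <- ps) ('X_ij.1 - 'X_ij.2)).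
Proof.
elim: ps gam => [|[i j] ps IH] gam.
  rewrite !big_nil addr0 -mpolyX0 kevalX /kmon /=; congr (kprod _).
  by apply/ffunP => i; rewrite !ffunE mnm0E subr0.
rewrite /= /one_minus_R /one_minus_shift !IH !big_cons /= mulrBl linearB /=.
rewrite !keval_mulU; set e := \sum_(_ <- _) _.
have -> : gam + (eps i + e) - eps i = gam + e by rewrite addrCA (addrC (eps i)) addrK.
have -> : gam + (eps i + e) - eps j = gam + (eps i - eps j) + e.
  by rewrite -!addrA (addrC e).
reflexivity.
Qed.

Lemma foldr_one_minus_L (zs : seq 'I_l) (F : weight l -> Sym) d p gam :
  (forall gam, F gam = keval (gam + d) p) ->
  foldr (@one_minus_L l) F zs gam = keval (gam + d) (\prod_(z <- zs) (1 - 'X_z) * p).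
Proof.
move=> FE; elim: zs gam => [|z zs IH] gam; first by rewrite big_nil mul1r.
rewrite /= /one_minus_L /one_minus_shift !IH big_cons -mulrA mulrBl mul1r linearB /=.
by rewrite keval_mulU addrAC; reflexivity.
Qed.

Lemma KatalanE (Psi : {set 'I_l * 'I_l}) (M : seq 'I_l) gam :
  Katalan Psi M gam =
  keval (gam + \sum_(ij in posroots l :\: Psi) eps ij.1)
    (\prod_(z <- M) (1 - 'X_z) * \prod_(ij in posroots l :\: Psi) ('X_ij.1 - 'X_ij.2)).
Proof.
rewrite /Katalan -[in RHS](big_enum (R := weight l)) -[in RHS](big_enum (R := mpoly l rat)) /=.
by apply: foldr_one_minus_L => g; exact: foldr_one_minus_R.
Qed.

(** The columns beyond [l] contribute a power of the variable of the row. *)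
Lemma krowE (i n : nat) : (i < l)%N -> krow l i n =
  xv l i ^+ ((i + n).+1 - l) *
  \prod_(i.+1 <= j < l) (if (j <= i + n)%N then xv l i - xv l j else yv l j).
Proof.
move=> il; rewrite krow.unlock; have [le|lt] := leqP (i + n).+1 l.
  rewrite (eqP (_ : ((i + n).+1 - l == 0)%N)) // expr0 mul1r.
  rewrite [in RHS](@big_cat_nat _ _ _ (i + n).+1) //=; last by lia.
  congr (_ * _); apply: eq_big_nat => j /andP[ij ji]; first by rewrite -ltnS ji.
  by rewrite leqNgt ij.
rewrite [X in _ * X]big_geq ?mulr1; last exact: ltnW.
rewrite (@big_cat_nat _ _ _ l) //=; last exact: ltnW.
rewrite mulrC; congr (_ * _).
  rewrite -prodr_const_nat; apply: eq_big_nat => j /andP[lj _].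
  by rewrite [xv l j]xv0 // subr0.
by apply: eq_big_nat => j /andP[_ jl]; rewrite ifT //; lia.
Qed.

End KatalanEval.

Lemma PoszE_sum (I : finType) (P : pred I) :
  Posz (\sum_(i | P i) 1)%N = \sum_(i | P i) 1%:Z.
Proof. by elim/big_rec2: _ => // i a b _ <-. Qed.

Section Gtilde.
Variables (k l : nat) (lam : l.-tuple nat).
Hypothesis lamk : all (leq^~ k) lam.

Let n (i : 'I_l) : nat := (k - tnth lam i)%N.

Lemma in_Delta (ij : 'I_l * 'I_l) :
  (ij \in Delta k lam) = (ij.1 < ij.2)%N && ~~ (ij.2 <= ij.1 + n ij.1)%N.
Proof. by rewrite !inE -ltnNge addnC. Qed.

(** A row [i] with [r] non-roots has its subscript shifted from [lam_i] to
[lam_i + r], which is [k] if the row has a root; otherwise the columns beyond [l]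
make up for the difference. *)
Lemma gtildeE : gtilde k lam = kphi k (krows k l [seq (k - a)%N | a <- lam]).
Proof.
have lek i : (tnth lam i <= k)%N by apply: (allP lamk); exact: mem_tnth.
have nthE (i : 'I_l) : nth k [seq (k - a)%N | a <- lam] i = n i.
  by rewrite (nth_map 0%N) ?size_tuple // /n (tnth_nth 0%N).
(* The powers contributed by the columns beyond l. *)
pose ex : multinom l := [multinom ((i + n i).+1 - l)%N | i < l].
pose fac (ij : 'I_l * 'I_l) : mpoly l rat :=
  if (ij.2 <= ij.1 + n ij.1)%N then 'X_ij.1 - 'X_ij.2 else 1 - 'X_ij.2.
have krowsE : krows k l [seq (k - a)%N | a <- lam] =
    'X_[ex] * \prod_(ij : 'I_l * 'I_l | (ij.1 < ij.2)%N) fac ij.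
  rewrite /krows big_mkord mpolyXE_id -(pair_big_dep xpredT
    (fun i j : 'I_l => i < j)%N (fun i j => fac (i, j))) /= -big_split /=.
  apply: eq_bigr => i _; rewrite nthE krowE // mnmE xv_ord; congr (_ * _).
  rewrite [RHS](eq_bigr (fun j : 'I_l =>
     if (j <= i + n i)%N then 'X_i - xv l j else yv l j)) => [|j _].
    rewrite -(big_mkord (fun j => i < j)%N (fun j =>
      if (j <= i + n i)%N then 'X_i - xv l j else yv l j)).
    rewrite (@big_nat_widenl _ _ _ i.+1 0%N) //; exact: eq_bigl.
  by rewrite /fac /= /yv xv_ord.
pose c : weight l := [ffun i => (tnth lam i)%:Z].
pose A := posroots l :\: Delta k lam.
have wE : c + \sum_(ij in A) eps ij.1 = [ffun=> k%:Z] - mnm_weight ex.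
  apply/ffunP => i; rewrite !ffunE sum_ffunE mnmE.
  have -> : \sum_(ij in A) eps ij.1 i = (\sum_(i.+1 <= j < minn l (i + n i).+1) 1)%N%:Z.
    transitivity (\sum_(a : 'I_l) \sum_(b | (a, b) \in A) eps a i).
      by rewrite pair_big_dep; apply: eq_bigl => -[a b].
    rewrite (bigD1 i) //= [X in _ + X]big1 ?addr0 => [|a ai]; last first.
      by rewrite big1 // => b _; rewrite ffunE eq_sym (negPf ai).
    rewrite (eq_bigr (fun=> 1%:Z)) => [|b _]; last by rewrite ffunE eqxx.
    rewrite (@big_nat_widenl _ _ _ i.+1 0%N) //.
    rewrite (@big_nat_widen _ _ _ _ _ l) ?geq_minl // big_mkord.
    rewrite PoszE_sum; apply: eq_bigl => b.
    rewrite /A in_setD in_Delta !inE /= leq_min ltn_ord ltnS.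
    by case: (i < b)%N; rewrite //= negbK andbT.
  rewrite sum_nat_const_nat muln1; have := lek i; have := ltn_ord i.
  by rewrite /n; lia.
rewrite krowsE /kphi keval_mulX -wE /gtilde KatalanE -/c -/A; congr (keval _ _).
rewrite [RHS](bigID (mem (Delta k lam))) /=; congr (_ * _).
  rewrite /Lset big_map big_enum /=; apply: eq_big => ij.
    by rewrite in_Delta andbA andbb.
  by rewrite in_Delta /fac => /andP[_ /negPf ->].
apply: eq_big => ij; first by rewrite !inE andbC; case: ltnP.
rewrite /A in_setD in_Delta !inE => /andP[]; rewrite negb_and => /orP[/negPf ->|] //.
by rewrite negbK /fac => ->.
Qed.
End Gtilde.

(** * Trailing zeros *)

Section DropLast.
Variables (k l : nat).

Definition drop_last (p : mpoly l.+1 rat) : mpoly l rat :=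
  p \mPo [tuple xv l i | i < l.+1].

HB.instance Definition _ := GRing.RMorphism.copy drop_last drop_last.
HB.instance Definition _ := GRing.Linear.copy drop_last drop_last.

Lemma drop_last_xv j : drop_last (xv l.+1 j) = xv l j.
Proof.
have [lt|le] := ltnP j l.+1; last by rewrite !xv0 ?rmorph0 //; exact: ltnW.
have -> : xv l.+1 j = 'X_(Ordinal lt) by rewrite -xv_ord.
by rewrite /drop_last comp_mpolyXU -tnth_nth tnth_mktuple.
Qed.

Lemma drop_last_yv j : drop_last (yv l.+1 j) = yv l j.
Proof. by rewrite /yv rmorphB rmorph1 /= drop_last_xv. Qed.

Lemma drop_last_krow i n : drop_last (krow l.+1 i n) = krow l i n.
Proof.
rewrite !krow.unlock rmorphM /= !rmorph_prod; congr (_ * _).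
  by apply: eq_bigr => j _; rewrite rmorphB /= !drop_last_xv.
transitivity (\prod_((i + n).+1 <= j < l.+1) yv l j).
  by apply: eq_bigr => j _; rewrite /= drop_last_yv.
have [le|lt] := leqP (i + n).+1 l; last by rewrite big_geq // big_geq // ltnW.
by rewrite big_nat_recr //= yv1 // mulr1.
Qed.

(** After a factor [x_l^k] the last subscript is at most zero, so that only the terms
without the last variable survive, and [k_0 = 1]. *)
Lemma kphi_drop_last p : kphi k (xv l.+1 l ^+ k * p) = kphi k (drop_last p).
Proof.
suff mono m : kphi k (xv l.+1 l ^+ k * 'X_[m]) = kphi k (drop_last 'X_[m]).
  elim/mpolyind: p => [|a m p _ _ IH]; first by rewrite mulr0 !linear0.
  by rewrite mulrDr -scalerAr [drop_last _]linearP !linearP /= IH mono.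
have -> : xv l.+1 l = 'X_ord_max by rewrite -xv_ord.
rewrite mpolyXn -mpolyXD /drop_last comp_mpolyX big_ord_recr tnth_mktuple /=.
rewrite kphiX big_ord_recr /= [xv l l]xv0 //.
have -> : (U_(ord_max) *+ k + m)%MM ord_max = (k + m ord_max)%N.
  by rewrite mnmDE mulmnE mnm1E eqxx mul1n.
have ex (i : 'I_l) : (U_(ord_max) *+ k + m)%MM (widen_ord (leqnSn l) i) =
    m (widen_ord (leqnSn l) i).
  by rewrite mnmDE mulmnE mnm1E -val_eqE /= gtn_eqF ?mul0n.
case: (m ord_max) => [|e]; last first.
  have -> : k%:Z - (k + e.+1)%N%:Z = Negz e by lia.
  have -> : kk l (Negz e) = 0 by [].
  by rewrite expr0n /= 2!mulr0 linear0.
rewrite addn0 subrr expr0 mulr1.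
have -> : kk l 0 = 1.
  by rewrite (kkE l 0) big_ord_recl big_ord0 bin0 scale1r addr0.
pose m' : multinom l := [multinom m (widen_ord (leqnSn l) i) | i < l].
have -> : \prod_(i < l) tnth [tuple xv l i | i < l.+1] (widen_ord (leqnSn l) i) ^+
    m (widen_ord (leqnSn l) i) = 'X_[m'].
  by rewrite mpolyXE_id; apply: eq_bigr => i _; rewrite tnth_mktuple xv_ord mnmE.
by rewrite kphiX mulr1; apply: eq_bigr => i _; rewrite ex mnmE.
Qed.

Lemma kphi_krows_rcons s : size s = l ->
  kphi k (krows k l.+1 (rcons s k)) = kphi k (krows k l s).
Proof.
move=> sz; rewrite /krows big_nat_recr //= nth_rcons sz ltnn eqxx.
have -> : krow l.+1 l k = xv l.+1 l ^+ k.
  rewrite krow.unlock [\prod_(_ <= j < l.+1) _]big_geq ?mulr1; last by lia.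
  rewrite -[k in RHS](_ : ((l + k).+1 - l.+1)%N = k); last by lia.
  rewrite -prodr_const_nat; apply: eq_big_nat => j /andP[zj _].
  by rewrite (@xv0 l.+1 j) ?subr0.
rewrite mulrC kphi_drop_last rmorph_prod; congr (kphi k _).
apply: eq_big_nat => i /andP[_ il]; rewrite nth_rcons sz il.
exact: drop_last_krow.
Qed.

End DropLast.

Definition gseq (k : nat) (s : seq nat) : Sym := gtilde k (in_tuple s).

Lemma gseqE k s : all (leq^~ k) s ->
  gseq k s = kphi k (krows k (size s) [seq (k - a)%N | a <- s]).
Proof. by move=> sk; exact: gtildeE. Qed.

Lemma gseq_rcons0 k s : all (leq^~ k) s -> gseq k (rcons s 0) = gseq k s.
Proof.
move=> sk; rewrite !gseqE ?all_rcons //.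
rewrite map_rcons subn0 size_rcons; apply: kphi_krows_rcons.
exact: size_map.
Qed.

Lemma gseq_filter k s : all (leq^~ k) s -> sorted geq s ->
  gseq k s = gseq k [seq a <- s | (0 < a)%N].
Proof.
elim/last_ind: s => // s a IH; rewrite all_rcons => /andP[ak sk] srt.
have srt' : sorted geq s.
  by move: srt; rewrite -cats1 => /cat_sorted2[].
rewrite filter_rcons; case: ltnP => [a0|].
  congr (gseq k (rcons _ a)); apply/esym/all_filterP/allP => b bs.
  apply: leq_trans a0 _; move: srt; rewrite -cats1.
  rewrite sorted_pairwise; last by move=> ? ? ? /= h1 h2; apply: leq_trans h2 h1.
  by rewrite pairwise_cat => /and3P[/allrelP H _ _]; apply: H => //; rewrite inE.
by rewrite leqn0 => /eqP ->; rewrite gseq_rcons0 // IH.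
Qed.

(** * The Hall inner product on products of complete functions *)

Lemma malgUU (a b : hmon) (c d : rat) :
  (monalg.mkmalgU a c : Sym) * (monalg.mkmalgU b d : Sym) =
  monalg.mkmalgU (monalg.mmul a b) (c * d).
Proof. by rewrite malgM_def; exact: fgmulUU. Qed.

Lemma malgU_scale (a : hmon) (c : rat) :
  (monalg.mkmalgU a c : Sym) = c *: (monalg.mkmalgU a 1 : Sym).
Proof.
apply/monalg.malgP => b.
rewrite [RHS]monalg.mcoeffZ [LHS]monalg.mcoeffU [X in _ * X]monalg.mcoeffU.
by rewrite mulrnAr mulr1.
Qed.

Definition hprod (t : seq nat) : Sym := \prod_(x <- t) hh x.

(** Parts equal to zero are allowed and disappear. *)
Definition hmono (t : seq nat) : hmon :=
  foldr (fun x a => if x is x'.+1 then monalg.mmul (monalg.ucm x') a else a)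
    (monalg.mone : hmon) t.

Lemma hmonoE t i : hmono t i = count_mem i.+1 t.
Proof.
elim: t => [|[|x] t IH] //=; first exact: cm1.
by rewrite cmM IH cmU eqSS.
Qed.

Lemma hprodE t : hprod t = monalg.mkmalgU (hmono t) 1.
Proof.
elim: t => [|x t IH]; first by rewrite /hprod big_nil.
rewrite /hprod big_cons -/(hprod t) IH; case: x => [|x]; first by rewrite mul1r.
by rewrite [LHS]malgUU; reflexivity.
Qed.

Lemma count_hparts a (i : nat) : count_mem i.+1 (hparts a) = a i.
Proof.
rewrite /hparts count_flatten -map_comp sumnE big_map.
rewrite (eq_bigr (fun j => if j == i then a j else 0%N)) => [|j _]; last first.
  by rewrite /= count_nseq /= eqSS; case: eqP => _; rewrite ?mul1n.
rewrite -big_mkcond /=; have [ia|nia] := boolP (i \in finsupp a).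
  rewrite -big_filter filter_pred1_uniq ?fset_uniq // big_seq1 //.
rewrite big_seq_cond big_pred0 => [|j]; first by move: nia; rewrite -cmE_eq0 => /eqP.
by case: eqP => [->|]; rewrite ?andbF // (negPf nia).
Qed.

Lemma hparts_gt0 a x : x \in hparts a -> (0 < x)%N.
Proof. by case/flatten_mapP => i _; rewrite mem_nseq => /andP[_ /eqP ->]. Qed.

Lemma hmono_hparts a : hmono (hparts a) = a.
Proof. by apply/eqP/cmP => i; rewrite hmonoE count_hparts. Qed.

Lemma perm_hparts t : perm_eq (hparts (hmono t)) [seq x <- t | (0 < x)%N].
Proof.
apply/allP => -[|x] _ /=; last first.
  by rewrite count_hparts hmonoE count_filter; apply/eqP/eq_count => -[|y] //=; rewrite andbT.
apply/eqP; transitivity 0%N; [|apply: esym]; apply/count_memPn; apply/negP.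
  by move/hparts_gt0.
by rewrite mem_filter.
Qed.

Lemma hallE u v :
  hall u v = monalg.mmap idfun (fun a => mcoef (hparts a) v) u.
Proof. by []. Qed.

Lemma hallD u u' v : hall (u + u') v = hall u v + hall u' v.
Proof. by rewrite !hallE monalg.mmapD. Qed.

Lemma hallZ c u v : hall (c *: u) v = c * hall u v.
Proof.
rewrite !hallE (monalg.mmapEw (monalg.msuppZ_le _ _)) monalg.mmapE mulr_sumr.
by apply: eq_bigr => a _; rewrite /= monalg.mcoeffZ mulrA.
Qed.

Lemma hallU a v : hall (monalg.mkmalgU a 1) v = mcoef (hparts a) v.
Proof. by rewrite hallE monalg.mmapU mul1r. Qed.

Lemma hall0 v : hall 0 v = 0.
Proof. by rewrite hallE monalg.mmap0. Qed.

Lemma hall_sum (I : Type) (r : seq I) (P : pred I) (F : I -> Sym) v :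
  hall (\sum_(i <- r | P i) F i) v = \sum_(i <- r | P i) hall (F i) v.
Proof.
elim/big_rec2: _ => [|i x y _ <-]; first exact: hall0.
exact: hallD.
Qed.

Lemma toX_symmetric n v (s : 'S_n) : msym s (toX n v) = toX n v.
Proof.
rewrite /toX monalg.mmapE [msym s _]raddf_sum; apply: eq_bigr => a _.
rewrite /= msymM /hmonX [msym s (\prod_(_ <- _) _)]rmorph_prod; congr (_ * _).
  by rewrite -[_%:MP]mulr1 mul_mpolyC msymZ msym1.
apply: eq_bigr => i _; rewrite rmorphXn /=; congr (_ ^+ _).
apply/mpolyP => m; rewrite mcoeff_sym !mcoeff_hpoly; congr (_ == _)%:R.
rewrite !mpoly.mdegE [RHS](reindex_inj (@perm_inj _ s)); apply: eq_bigr => j _.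
by rewrite mnmE.
Qed.

(** Setting the last variable to zero keeps exactly the monomials without it. *)
Lemma mcoeff_drop_last n (p : mpoly n.+1 rat) (m : multinom n) (M : multinom n.+1) :
  (forall i : 'I_n, M (widen_ord (leqnSn n) i) = m i) -> M ord_max = 0%N ->
  (drop_last p)@_m = p@_M.
Proof.
move=> Mm M0; suff mono m' : (drop_last 'X_[m'])@_m = ('X_[m'] : mpoly n.+1 rat)@_M.
  elim/mpolyind: p => [|c m' p _ _ IH]; first by rewrite [drop_last 0]linear0 !mcoeff0.
  by rewrite [drop_last _]linearP !mcoeffD !mcoeffZ /= IH mono.
rewrite /drop_last comp_mpolyX big_ord_recr /= tnth_mktuple [xv n ord_max]xv0 //.
pose m2 : multinom n := [multinom m' (widen_ord (leqnSn n) i) | i < n].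
have -> : \prod_(i < n) tnth [tuple xv n i | i < n.+1] (widen_ord (leqnSn n) i) ^+
    m' (widen_ord (leqnSn n) i) = 'X_[m2].
  by rewrite mpolyXE_id; apply: eq_bigr => i _; rewrite tnth_mktuple xv_ord mnmE.
rewrite [RHS]mcoeffX expr0n; case: (eqVneq (m' ord_max) 0%N) => m'0; last first.
  rewrite mulr0 mcoeff0; case: eqP => // e.
  by move: m'0; rewrite e M0.
rewrite mulr1 mcoeffX; congr (nat_of_bool _)%:R; apply/eqP/eqP => e.
  apply/mnmP => i; have [j ->|->] := unliftP ord_max i; last by rewrite M0.
  have -> : lift ord_max j = widen_ord (leqnSn n) j by apply: val_inj; exact: lift_max.
  by rewrite Mm -e mnmE.
by apply/mnmP => i; rewrite mnmE e Mm.
Qed.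

Lemma drop_last_hpoly n d : drop_last (hpoly n.+1 d) = hpoly n d.
Proof.
apply/mpolyP => m.
pose M : multinom n.+1 := [multinom (if insub (i : nat) is Some j then m j else 0%N) | i < n.+1].
rewrite (@mcoeff_drop_last _ _ _ M) => [|i|].
- rewrite !mcoeff_hpoly !mpoly.mdegE big_ord_recr /= mnmE insubN ?ltnn // addn0.
  congr (_ == _)%:R; apply: eq_bigr => i _; rewrite mnmE /=.
  by rewrite valK.
- by rewrite mnmE /= valK.
by rewrite mnmE insubN // ltnn.
Qed.

Lemma drop_last_toX n v : drop_last (toX n.+1 v) = toX n v.
Proof.
rewrite /toX !monalg.mmapE [drop_last _]raddf_sum; apply: eq_bigr => a _.
rewrite /= [drop_last _]rmorphM /= /hmonX [drop_last (\prod_(_ <- _) _)]rmorph_prod.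
congr (_ * _); first exact: comp_mpolyC.
by apply: eq_bigr => i _; rewrite rmorphXn /= drop_last_hpoly.
Qed.

Definition mseq n (t : seq nat) : multinom n := [multinom nth 0%N t i | i < n].

(** The number of variables is irrelevant once it is large enough. *)
Lemma mcoefE n t v : (size t <= n)%N -> mcoef t v = (toX n v)@_(mseq n t).
Proof.
move=> /subnK <-; elim: (n - size t)%N => [|d IH]; last first.
  rewrite IH -drop_last_toX; apply: mcoeff_drop_last => [i|]; first by rewrite !mnmE.
  by rewrite mnmE nth_default //= leq_addl.
rewrite /mcoef; congr (_@__); apply/mnmP => i.
by rewrite mnmE /= multinomE (tnth_nth 0%N).
Qed.

Lemma mcoef_cat0 t d v : mcoef (t ++ nseq d 0%N) v = mcoef t v.
Proof.
have sz : (size t <= size (t ++ nseq d 0%N))%N by rewrite size_cat leq_addr.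
rewrite (mcoefE v sz) (mcoefE v (leqnn _)); congr (_@__).
apply/mnmP => i; rewrite !mnmE nth_cat nth_nseq; case: ltnP => // ti.
by rewrite if_same nth_default.
Qed.

Lemma mcoef_perm t t' v : perm_eq t t' -> mcoef t v = mcoef t' v.
Proof.
move=> pt; have sz := perm_size pt.
have /tuple_permP[s ts] : perm_eq t (in_tuple t') by [].
rewrite (mcoefE v (leqnn (size t))) sz (mcoefE v (leqnn (size t'))).
rewrite -[toX _ v in RHS](toX_symmetric v s) mcoeff_sym; congr (_@__).
apply/mnmP => i; rewrite !mnmE ts -tnth_nth tnth_mktuple.
by rewrite (tnth_nth 0%N).
Qed.

Lemma mcoef_filter t v : mcoef [seq x <- t | (0 < x)%N] v = mcoef t v.
Proof.
pose z := [seq x <- t | ~~ (0 < x)%N].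
have zE : z = nseq (size z) 0%N.
  apply/all_pred1P/allP => x; rewrite mem_filter -eqn0Ngt => /andP[/eqP -> _].
  exact: eqxx.
by rewrite -(mcoef_cat0 _ (size z)) -zE; apply: mcoef_perm; rewrite perm_filterC.
Qed.

(** The order of the parts is irrelevant since [toX] takes symmetric values. *)
Lemma hall_hprod t v : hall (hprod t) v = mcoef t v.
Proof.
by rewrite hprodE hallU (mcoef_perm v (perm_hparts t)) mcoef_filter.
Qed.

Lemma Sym_ind (P : Sym -> Prop) :
  (forall c a, P (c *: hprod (hparts a))) -> (forall u w, P u -> P w -> P (u + w)) ->
  forall u, P u.
Proof.
move=> PU PD u; have P0 : P 0 by rewrite -(scale0r (hprod (hparts monalg.mone))).
rewrite (monalg.monalgE u); elim/big_rec: _ => // a w _ Pw; apply: PD => //.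
rewrite -(hmono_hparts a).
have -> : (monalg.mkmalgU (hmono (hparts a)) (monalg.mcoeff (hmono (hparts a)) u) : Sym) =
  monalg.mcoeff (hmono (hparts a)) u *: hprod (hparts a).
  by rewrite hprodE; exact: malgU_scale.
exact: PU.
Qed.

(** This is the fundamental theorem on symmetric polynomials, as the image of [ee]
is the elementary symmetric polynomial. *)
Lemma toX_surj n (p : mpoly n rat) : p \is symmetric -> exists v, toX n v = p.
Proof.
move=> /sym_fundamental[t [tp _]].
exists (mpoly.mmap (fun c : rat => monalg.mkmalgU monalg.mone c : Sym) (fun i : 'I_n => ee i.+1) t).
rewrite -tp /comp_mpoly /mpoly.mmap raddf_sum; apply: eq_bigr => m _ /=.
rewrite [LHS](rmorphM (toX n)) /mmap1 [X in _ * X](rmorph_prod (toX n)).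
congr (_ * _); first by rewrite /toX; exact: monalg.mmapC.
apply: eq_bigr => i _; rewrite [LHS](rmorphXn (toX n)) /= [X in X ^+ _]toX_ee.
by rewrite tnth_mktuple.
Qed.

(** * Nondegeneracy and the adjoint of e_d *)

Lemma count_nth_sum (t : seq nat) N x : (size t <= N)%N -> (0 < x)%N ->
  count_mem x t = (\sum_(j < N) (nth 0%N t j == x))%N.
Proof.
move=> sz x0; rewrite -(big_mkord xpredT (fun j => (nth 0%N t j == x) : nat)).
rewrite (@big_cat_nat _ _ _ (size t)) //= [X in (_ + X)%N]big_nat_cond.
rewrite [X in (_ + X)%N]big1 ?addn0 => [|j /andP[/andP[tj _] _]]; last first.
  by rewrite nth_default //; case: x x0.
rewrite -sum1_count (big_nth 0%N) big_mkcond.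
by apply: eq_bigr => j _ /=; case: eqP.
Qed.

Lemma mseq_perm N (s : 'S_N) a b :
  (size (hparts a) <= N)%N -> (size (hparts b) <= N)%N ->
  mseq N (hparts a) = [multinom mseq N (hparts b) (s i) | i < N] -> a = b.
Proof.
move=> sa sb /mnmP e; apply/eqP/cmP => i.
rewrite -!count_hparts (count_nth_sum sa) // (count_nth_sum sb) //.
rewrite [RHS](reindex_inj (@perm_inj _ s)); apply: eq_bigr => j _.
by have := e j; rewrite !mnmE => ->.
Qed.

(** For a monomial [a] of [w], pair [w] with a symmetric function whose image in
enough variables is the sum of the orbit of x^a: no other monomial of [w]
contributes. *)
Lemma hall_nondegenerate w : (forall v, hall w v = 0) -> w = 0.
Proof.
move=> w0; apply/eqP; rewrite -monalg.msupp_eq0; apply: contraT => /fset0Pn[a aw].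
pose N := (\max_(b <- monalg.msupp w) size (hparts b))%N.
have szN b : b \in monalg.msupp w -> (size (hparts b) <= N)%N.
  by move=> bw; rewrite /N (big_rem b) //= leq_maxl.
(* The coefficients are the orders of stabilisers, hence nonzero. *)
pose p : mpoly N rat := \sum_(s : 'S_N) msym s 'X_[mseq N (hparts a)].
have psym : p \is symmetric.
  apply/issymP => s; rewrite /p [LHS]raddf_sum /= [RHS](reindex_inj (mulIg s)).
  by apply: eq_bigr => u _; rewrite msymMm.
have [v vp] := toX_surj psym; have := w0 v.
have coefp b : b \in monalg.msupp w -> mcoef (hparts b) v =
    \sum_(s : 'S_N) (mseq N (hparts a) == [multinom mseq N (hparts b) (s i) | i < N])%:R.
  move=> bw; rewrite (mcoefE v (szN b bw)) vp /p raddf_sum /=.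
  by apply: eq_bigr => s _; rewrite mcoeff_sym; exact: mcoeffX.
have coef0 b : b \in monalg.msupp w -> b != a -> mcoef (hparts b) v = 0.
  move=> bw ba; rewrite (coefp b bw) big1 // => s _; case: eqP => // e.
  by move: ba; rewrite (mseq_perm (szN a aw) (szN b bw) e) eqxx.
rewrite hallE monalg.mmapE (big_fsetD1 a aw) big_seq big1 => [|b]; last first.
  by rewrite in_fsetD1 => /andP[ba bw]; rewrite (coef0 b bw ba) mulr0.
move/eqP; rewrite /= addr0 mulf_eq0 monalg.mcoeff_eq0 aw (coefp a aw) -natr_sum pnatr_eq0.
have e1 : mseq N (hparts a) == [multinom mseq N (hparts a) ((1%g : 'S_N) i) | i < N].
  by apply/eqP/mnmP => i; rewrite !mnmE perm1.
by rewrite (bigD1 1%g) //= e1.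
Qed.

Section Universal.
Variables (A : comNzRingType) (f : {rmorphism rat -> A}) (g : nat -> A).

Definition gmono (a : hmon) : A := \prod_(i <- finsupp a) g i ^+ a i.

Lemma gmonoE (a : hmon) (D : {fset nat}) : (finsupp a `<=` D)%fset ->
  gmono a = \prod_(i <- D) g i ^+ a i.
Proof.
move=> le; rewrite /gmono (big_fset_incl _ le) // => i _.
by rewrite -cmE_eq0 => /eqP ->; rewrite expr0.
Qed.

Lemma gmono_mmorphism : mmorphism gmono.
Proof.
split=> [a b|]; last by rewrite /gmono mdom1 big_seq_fset0.
rewrite (gmonoE (fsubsetUl (finsupp a) (finsupp b))).
rewrite (gmonoE (fsubsetUr (finsupp a) (finsupp b))).
rewrite /gmono mdomD -big_split /=; apply: eq_bigr => i _.
by rewrite cmM exprD.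
Qed.

HB.instance Definition _ :=
  monalg.isMultiplicative.Build hmon A gmono gmono_mmorphism.

(** The universal property of the polynomial ring in [h_1, h_2, ...]. *)
Definition symeval : Sym -> A := monalg.mmap f gmono.

HB.instance Definition _ := GRing.RMorphism.copy symeval (monalg.mmap f gmono).

Lemma symeval_hh d : symeval (hh d.+1) = g d.
Proof.
rewrite /symeval /hh monalg.mmapU /= rmorph1 mul1r /gmono mdomU big_seq_fset1.
by rewrite cmUU expr1.
Qed.

Lemma symevalZ c u : symeval (c *: u) = f c * symeval u.
Proof. by rewrite -monalg.mul_malgC rmorphM /= [symeval _]monalg.mmapC. Qed.

End Universal.

Lemma coef_prod_lin (A : comNzRingType) n (a b : 'I_n -> A) d :
  (\prod_i ((a i)%:P + (b i)%:P * 'X))`_d =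
  \sum_(S : {set 'I_n} | #|S| == d) \prod_i (if i \in S then b i else a i).
Proof.
have -> : \prod_i ((a i)%:P + (b i)%:P * 'X) = \sum_(S : {set 'I_n}) \prod_i
    (if i \in S then (b i)%:P * 'X else (a i)%:P) :> {poly A}.
  transitivity (\prod_i ((b i)%:P * 'X + (a i)%:P)).
    by apply: eq_bigr => i _; rewrite addrC.
  exact: bigA_distr.
rewrite coef_sum [RHS]big_mkcond /=; apply: eq_bigr => S _.
have -> : \prod_i (if i \in S then (b i)%:P * 'X else (a i)%:P) =
    (\prod_i (if i \in S then b i else a i))%:P * 'X^#|S| :> {poly A}.
  rewrite -sum1_card -prodrXr rmorph_prod [X in _ = _ * X]big_mkcond -big_split /=.
  by apply: eq_bigr => i _; case: ifP; rewrite ?mulr1.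
by rewrite coefCM coefXn eq_sym; case: ifP => _; rewrite ?mulr1 ?mulr0.
Qed.

(** This is [h_(d-1)], with [h_(-1) = 0]. *)
Definition hh_pred d : Sym := if d is d'.+1 then hh d' else 0.

Definition efactor d : {poly Sym} := (hh d)%:P + (hh_pred d)%:P * 'X.

Definition constP : rat -> {poly Sym} := polyC \o (@monalg.mkmalgU hmon rat monalg.mone).

HB.instance Definition _ := GRing.RMorphism.copy constP
   (polyC \o (@monalg.mkmalgU hmon rat monalg.mone)).

(** The generating function of the [e_d]^perp: as the coproduct of
[sum_d e_d X^d] is its tensor square, it is a ring morphism. *)
Definition eshift : Sym -> {poly Sym} := symeval constP (fun i => efactor i.+1).

HB.instance Definition _ := GRing.RMorphism.copy eshift
  (symeval constP (fun i => efactor i.+1)).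

HB.lock Definition eperp d (u : Sym) : Sym := (eshift u)`_d.

Lemma eshift_hh d : eshift (hh d) = efactor d.
Proof.
case: d => [|d]; last exact: symeval_hh.
by rewrite /efactor /= mul0r addr0; exact: rmorph1.
Qed.

Lemma eshiftZ c u : eshift (c *: u) = constP c * eshift u.
Proof. exact: symevalZ. Qed.

Lemma eperpZ d c u : eperp d (c *: u) = c *: eperp d u.
Proof. by rewrite eperp.unlock eshiftZ /constP /= coefCM monalg.mul_malgC. Qed.

Lemma eperpD d u w : eperp d (u + w) = eperp d u + eperp d w.
Proof. by rewrite eperp.unlock [eshift _]rmorphD coefD. Qed.

Lemma eperp0 d : eperp d 0 = 0.
Proof. by rewrite -(scale0r (0 : Sym)) eperpZ !scale0r. Qed.

Lemma eshift_hprod n (t : 'I_n -> nat) :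
  eshift (\prod_(i < n) hh (t i)) = \prod_(i < n) efactor (t i).
Proof. by rewrite rmorph_prod; apply: eq_bigr => i _; exact: eshift_hh. Qed.

Lemma hprod_ord (t : seq nat) : hprod t = \prod_(i < size t) hh (nth 0%N t i).
Proof. by rewrite /hprod (big_nth 0%N) big_mkord. Qed.

Lemma eperp_hprod d (t : seq nat) :
  eperp d (hprod t) = \sum_(S : {set 'I_(size t)} | #|S| == d)
    \prod_i (if i \in S then hh_pred (nth 0%N t i) else hh (nth 0%N t i)).
Proof. by rewrite eperp.unlock hprod_ord eshift_hprod; exact: coef_prod_lin. Qed.

(** On both sides one chooses [d] of the parts and lowers them by one: on the left
in a product of complete functions, on the right in the exponents of the
monomials of the elementary polynomial times [v]. *)
Lemma eperp_adjoint d : is_adjoint (ee d) (eperp d).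
Proof.
move=> u v; elim/Sym_ind: u => [c a|u w IHu IHw]; last first.
  by rewrite eperpD [LHS]hallD [RHS]hallD IHu IHw.
rewrite eperpZ [LHS]hallZ [RHS]hallZ; congr (_ * _).
set t := hparts a.
rewrite eperp_hprod hall_sum hall_hprod /mcoef rmorphM /=.
rewrite [X in X * _]toX_ee mesymE mulr_suml [RHS]raddf_sum /=.
apply: eq_bigr => S _; rewrite mulrC.
pose t' := [seq (nth 0%N t i - (i \in S))%N | i : 'I_(size t)].
have st' : size t' = size t by rewrite size_map size_enum_ord.
have nth' (i : 'I_(size t)) : nth 0%N t' i = (nth 0%N t i - (i \in S))%N.
  by rewrite (nth_map i) ?size_enum_ord // nth_ord_enum.
have t0 (i : 'I_(size t)) : (0 < nth 0%N t i)%N.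
  by apply: (@hparts_gt0 a); exact: mem_nth.
have -> : \prod_i (if i \in S then hh_pred (nth 0%N t i) else hh (nth 0%N t i)) = hprod t'.
  rewrite hprod_ord st'; apply: eq_bigr => i _; rewrite nth'.
  case: (i \in S); last by rewrite subn0; reflexivity.
  case: (nth 0%N t i) (t0 i) => [//|x _]; rewrite subn1; reflexivity.
rewrite hall_hprod (@mcoefE (size t)) ?st' //.
have -> : Multinom (in_tuple t) = (mesym1 S + mseq (size t) t')%MM.
  apply/mnmP => i; rewrite mnmDE !mnmE nth' multinomE (tnth_nth 0%N) /=.
  by case: (i \in S); rewrite ?subn0 // subn1 add1n prednK.
by rewrite mcoeffMX.
Qed.

Lemma perp_ee d u : perp (ee d) u = eperp d u.
Proof.
have adj : is_adjoint (ee d) (perp (ee d)).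
  by apply: epsilon_spec; exists (eperp d); exact: eperp_adjoint.
apply/eqP; rewrite -subr_eq0; apply/eqP/hall_nondegenerate => v.
by rewrite hallD -scaleN1r hallZ mulN1r adj eperp_adjoint subrr.
Qed.

Lemma eshift_sum (I : Type) (r : seq I) (c : I -> rat) (F : I -> Sym) :
  eshift (\sum_(i <- r) c i *: F i) = \sum_(i <- r) constP (c i) * eshift (F i).
Proof. by rewrite rmorph_sum; apply: eq_bigr => i _; exact: eshiftZ. Qed.

Lemma constPM c (u : Sym) : (c *: u)%:P = constP c * u%:P.
Proof. by rewrite -monalg.mul_malgC polyCM; reflexivity. Qed.

Lemma polyC_sumZ (I : Type) (r : seq I) (c : I -> rat) (F : I -> Sym) :
  (\sum_(i <- r) c i *: F i)%:P = \sum_(i <- r) constP (c i) * (F i)%:P.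
Proof.
elim/big_rec2: _ => [|i p q _ <-]; first exact: polyC0.
by rewrite polyCD constPM; reflexivity.
Qed.

Lemma eshift_kk r m : eshift (kk r m) = (kk r m)%:P + (kk r (m - 1))%:P * 'X.
Proof.
case: m => m; last first.
  have -> : Negz m - 1 = Negz m.+1 by lia.
  by rewrite /kk /= mul0r addr0; exact: rmorph0.
have -> : kk r (m%:Z - 1) = \sum_(i < m.+1) 'C((r + i).-1, i)%:R *: hh_pred (m - i).
  case: m => [|m].
    have -> : Posz 0 - 1 = Negz 0 by lia.
    rewrite big_ord_recl big_ord0 addr0.
    have -> : hh_pred (0 - (ord0 : 'I_1)) = 0 by [].
    by rewrite scaler0; reflexivity.
  have -> : m.+1%:Z - 1 = m%:Z by lia.
  rewrite kkE [RHS]big_ord_recr /= subnn scaler0 addr0.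
  by apply: eq_bigr => i _; rewrite subSn; [reflexivity | by rewrite -ltnS].
rewrite kkE eshift_sum; pose c (i : 'I_m.+1) : rat := 'C((r + i).-1, i)%:R.
have e1 := polyC_sumZ (index_enum 'I_m.+1) c (fun i => hh (m - i)).
have e2 := polyC_sumZ (index_enum 'I_m.+1) c (fun i => hh_pred (m - i)).
have e := congr2 (fun p q : {poly Sym} => p + q * 'X) e1 e2.
apply: (etrans _ (esym e)); rewrite [X in _ = _ + X]mulr_suml -[RHS]big_split /=.
by apply: eq_bigr => i _; rewrite eshift_hh /efactor mulrDr mulrA; reflexivity.
Qed.

Lemma eperp_kprod l d (gam : weight l) : eperp d (kprod gam) =
  \sum_(S : {set 'I_l} | #|S| == d) kprod (gam - mnm_weight (mesym1 S)).
Proof.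
rewrite eperp.unlock /kprod rmorph_prod.
rewrite (eq_bigr (fun i : 'I_l => (kk i (gam i))%:P + (kk i (gam i - 1))%:P * 'X));
  last by move=> i _; exact: eshift_kk.
rewrite coef_prod_lin; apply: eq_bigr => S _; apply: eq_bigr => i _.
by rewrite !ffunE mnmE; case: (i \in S); rewrite ?subr0.
Qed.

Lemma eperp_keval l d (c : weight l) p : eperp d (keval c p) = keval c (mesym l rat d * p).
Proof.
suff mono m : eperp d (keval c 'X_[m]) = keval c (mesym l rat d * 'X_[m]).
  elim/mpolyind: p => [|a m p _ _ IH].
    by rewrite mulr0 linear0 eperp0.
  have -> : mesym l rat d * (a *: 'X_[m] + p) =
      a *: (mesym l rat d * 'X_[m]) + mesym l rat d * p by rewrite mulrDr scalerAr.
  rewrite 2!keval_is_linear eperpD eperpZ.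
  exact: (congr2 (fun u v : Sym => a *: u + v) (mono m) IH).
rewrite kevalX eperp_kprod mesymE mulr_suml [RHS]linear_sum; apply: eq_bigr => S _ /=.
rewrite keval_mulX kevalX /kmon; congr (kprod _).
by apply/ffunP => i; rewrite !ffunE addrAC.
Qed.

(** * Leading terms *)

Definition supp_in (P : hmon -> Prop) (u : Sym) :=
  forall a, monalg.mcoeff a u != 0 -> P a.

Lemma supp_in0 P : supp_in P 0.
Proof. by move=> a; rewrite monalg.mcoeff0 eqxx. Qed.

Lemma supp_inD P u w : supp_in P u -> supp_in P w -> supp_in P (u + w).
Proof.
move=> Pu Pw a; rewrite monalg.mcoeffD => nz.
have [u0|] := eqVneq (monalg.mcoeff a u) 0; last exact: Pu.
by apply: Pw; move: nz; rewrite u0 add0r.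
Qed.

Lemma supp_inZ P c u : supp_in P u -> supp_in P (c *: u).
Proof.
by move=> Pu a; rewrite monalg.mcoeffZ mulf_eq0 negb_or => /andP[_]; exact: Pu.
Qed.

Lemma supp_inN P u : supp_in P u -> supp_in P (- u).
Proof. by rewrite -scaleN1r; exact: supp_inZ. Qed.

Lemma supp_in_sum P (I : Type) (r : seq I) (Q : pred I) (F : I -> Sym) :
  (forall i, Q i -> supp_in P (F i)) -> supp_in P (\sum_(i <- r | Q i) F i).
Proof.
by move=> PF; elim/big_rec: _ => [|i u Qi Pu]; [exact: supp_in0 | apply: supp_inD; auto].
Qed.

Lemma supp_inW (P Q : hmon -> Prop) u : (forall a, P a -> Q a) -> supp_in P u -> supp_in Q u.
Proof. by move=> PQ Pu a /Pu/PQ. Qed.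

Lemma supp_in_hprod P t : P (hmono t) -> supp_in P (hprod t).
Proof.
move=> Pt a; rewrite hprodE monalg.mcoeffU1.
by case: (hmono t =P a) => [<-|_]; rewrite ?eqxx.
Qed.

Definition degree (a : hmon) : nat := sumn (hparts a).
Definition sqsum (t : seq nat) : nat := sumn [seq (x ^ 2)%N | x <- t].

Lemma degree_hmono t : degree (hmono t) = sumn t.
Proof.
rewrite /degree (perm_sumn (perm_hparts t)).
by elim: t => //= -[|x] t IH /=; rewrite IH.
Qed.

Lemma sqsum_hmono t : sqsum (hparts (hmono t)) = sqsum t.
Proof.
rewrite /sqsum (perm_sumn (perm_map _ (perm_hparts t))).
by elim: t => //= -[|x] t IH /=; rewrite IH.
Qed.

Lemma sumn_image (I : finType) (F : I -> nat) : sumn [seq F i | i : I] = (\sum_i F i)%N.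
Proof. by rewrite sumnE big_map big_enum. Qed.

Lemma sub_rearrange (V : zmodType) (a b c d : V) :
  a - b - c = (a - c) - (b - d) - d.
Proof. by rewrite opprB addrA [RHS]addrAC addrK addrAC. Qed.

Section LeadingTerm.
Variable l : nat.
Implicit Types (gam al be : weight l).

Definition wdeg gam : int := \sum_i gam i.
Definition wseq gam : seq nat := [seq `|gam i|%N | i : 'I_l].
Definition nonneg gam := [forall i, 0 <= gam i].
Definition hweight gam : Sym := if nonneg gam then hprod (wseq gam) else 0.

Lemma wdegD gam al : wdeg (gam + al) = wdeg gam + wdeg al.
Proof. by rewrite /wdeg -big_split; apply: eq_bigr => i _; rewrite ffunE. Qed.

Lemma wdeg_eps i : wdeg (eps i) = 1.
Proof.
rewrite /wdeg (bigD1 i) //= big1 ?addr0 => [|j ji]; first by rewrite ffunE eqxx.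
by rewrite ffunE (negPf ji).
Qed.

Lemma wdegN al : wdeg (- al) = - wdeg al.
Proof. by rewrite /wdeg -sumrN; apply: eq_bigr => i _; rewrite ffunE. Qed.

Lemma wseq_deg gam : nonneg gam -> (sumn (wseq gam))%:Z = wdeg gam.
Proof.
move=> /forallP g0; rewrite sumn_image /wdeg.
rewrite (big_morph Posz PoszD (erefl _)); apply: eq_bigr => i _.
by rewrite gez0_abs.
Qed.

Lemma hprod_wseq gam : hprod (wseq gam) = \prod_(i < l) hh `|gam i|%N.
Proof. by rewrite /hprod big_map big_enum. Qed.

Definition degree_lt (d : int) (a : hmon) := (degree a)%:Z < d.

Lemma kkE_wide N r m : (m < N)%N ->
  kk r m%:Z = \sum_(i < N | (i <= m)%N) 'C((r + i).-1, i)%:R *: hh (m - i).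
Proof.
move=> mN; rewrite kkE (big_ord_widen _ (fun i => 'C((r + i).-1, i)%:R *: hh (m - i)) mN).
by apply: eq_bigl.
Qed.

(** [k_m^(r)] is [h_m] plus terms of lower degree. *)
Lemma kprod_hweight gam : supp_in (degree_lt (wdeg gam)) (kprod gam - hweight gam).
Proof.
rewrite /hweight; case: (boolP (nonneg gam)) => [g0|/forallPn[i gi]]; last first.
  rewrite /kprod (bigD1 i) //= [kk i _](_ : _ = 0) ?mul0r ?subr0; first exact: supp_in0.
  by case: (gam i) gi.
pose g i := `|gam i|%N; have gE i : gam i = (g i)%:Z.
  by move/forallP: g0 => g0; rewrite gez0_abs.
(* A common range for the sums defining the factors, to distribute them. *)
pose N := (\max_i g i).+1.
have gN i : (g i < N)%N by rewrite ltnS; exact: leq_bigmax.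
pose c (i : 'I_l) (j : 'I_N) : rat := 'C((i + j).-1, j)%:R.
pose T (f : {ffun 'I_l -> 'I_N}) : Sym := \prod_i (c i (f i) *: hh (g i - f i)).
have kE : kprod gam =
    \sum_(f in family (fun (i : 'I_l) (j : 'I_N) => (j <= g i)%N)) T f.
  rewrite /kprod (eq_bigr (fun i : 'I_l => \sum_(j < N | (j <= g i)%N) c i j *: hh (g i - j))).
    exact: bigA_distr_big_dep.
  by move=> i _; rewrite gE; exact: kkE_wide.
pose f0 : {ffun 'I_l -> 'I_N} := [ffun=> ord0].
have f0P : f0 \in family (fun (i : 'I_l) (j : 'I_N) => (j <= g i)%N).
  by apply/familyP => i; rewrite ffunE.
have T0 : T f0 = hprod (wseq gam).
  rewrite hprod_wseq; apply: eq_bigr => i _.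
  by rewrite ffunE /c addn0 bin0 scale1r subn0; reflexivity.
have -> : kprod gam - hprod (wseq gam) = \sum_(f | (f \in family (fun (i : 'I_l)
    (j : 'I_N) => (j <= g i)%N)) && (f != f0)) T f.
  by rewrite kE (bigD1 f0 f0P) T0 addrC; exact: addKr.
apply: supp_in_sum => f /andP[/familyP fg ff0].
have -> : T f =
    (\prod_i c i (f i)) *: hprod [seq (g i - f i)%N | i : 'I_l].
  by rewrite /T scaler_prod /hprod big_map big_enum; reflexivity.
apply: supp_inZ; apply: supp_in_hprod; rewrite /degree_lt degree_hmono.
rewrite -(wseq_deg g0) ltz_nat /wseq !sumn_image.
have [i fi] : exists i, (0 < f i)%N.
  apply/existsP; apply: contraR ff0; rewrite negb_exists => /forallP f0'.
  by apply/eqP/ffunP => i; apply/val_inj; rewrite ffunE /=; have := f0' i; case: (f i : nat).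
rewrite (bigD1 i) //= [X in (_ < X)%N](bigD1 i) //= -/(g i).
apply: (@leq_ltn_trans ((g i - f i) + \sum_(j | j != i) g j)%N).
  by rewrite leq_add2l; apply: leq_sum => j _; exact: leq_subr.
rewrite ltn_add2r ltn_subrL fi /=; apply: leq_trans fi _; exact: (fg i).
Qed.

Variable nu : 'I_l -> int.
Hypothesis nu_mono : forall i j : 'I_l, (i < j)%N -> nu j <= nu i.

Definition dot (f : 'I_l -> int) be : int := \sum_i f i * be i.

Lemma dotD f al be : dot f (al + be) = dot f al + dot f be.
Proof. by rewrite /dot -big_split; apply: eq_bigr => i _; rewrite ffunE mulrDr. Qed.

Lemma dot_root f i j : dot f (eps i - eps j) = f i - f j.
Proof.
have dot_eps o : dot f (eps o) = f o.
  rewrite /dot (bigD1 o) //= big1 ?addr0 => [|o' oo']; first by rewrite ffunE eqxx mulr1.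
  by rewrite ffunE (negPf oo') mulr0.
rewrite dotD dot_eps; congr (_ + _); rewrite -dot_eps /dot -sumrN.
by apply: eq_bigr => o _; rewrite ffunE mulrN.
Qed.

(** A set of weights closed under addition that contains the positive roots.  For
[be] in it, the sum of squares of [nu + be] exceeds that of [nu]: the second
condition makes the double product nonnegative, and the third one ensures that
[be] is not zero. *)
Definition raising be := [/\ wdeg be = 0, 0 <= dot nu be & dot (fun i => i%:Z) be < 0].

Lemma raisingD al be : raising al -> raising be -> raising (al + be).
Proof. by move=> [a1 a2 a3] [b1 b2 b3]; split; rewrite ?wdegD ?dotD; lia. Qed.

Lemma raising_root (i j : 'I_l) : (i < j)%N -> raising (eps i - eps j).
Proof.
move=> ij; split; rewrite ?wdegD ?wdegN ?wdeg_eps ?dot_root //; last by lia.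
by have := nu_mono ij; lia.
Qed.

(** The monomials that the operators [1 - L_z] and [1 - R_ij] can produce from
[h_gam], apart from [h_gam] itself. *)
Definition lower_or_raised gam (a : hmon) := degree_lt (wdeg gam) a \/
  exists2 be, raising be & nonneg (gam + be) /\ a = hmono (wseq (gam + be)).

Definition unitriangular (F : weight l -> Sym) :=
  forall gam, supp_in (lower_or_raised gam) (F gam - hweight gam).

Lemma unitriangular_kprod : unitriangular (@kprod l).
Proof. by move=> gam; apply: (@supp_inW _ _ _ _ (@kprod_hweight gam)) => a; left. Qed.

Lemma lower_or_raised_degree gam a : lower_or_raised gam a -> (degree a)%:Z <= wdeg gam.
Proof.
case=> [|[be [b0 _ _] [gb ->]]]; first exact: ltW.
by rewrite degree_hmono wseq_deg // wdegD b0 addr0.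
Qed.

Lemma supp_in_hweight (P : hmon -> Prop) gam : (nonneg gam -> P (hmono (wseq gam))) ->
  supp_in P (hweight gam).
Proof.
rewrite /hweight; case: ifP => [g0 Pg|_ _]; last exact: supp_in0.
by apply: supp_in_hprod; exact: Pg.
Qed.

Lemma unitriangular_R (ij : 'I_l * 'I_l) F : (ij.1 < ij.2)%N ->
  unitriangular F -> unitriangular (one_minus_R ij F).
Proof.
move=> lt uF gam; rewrite /one_minus_R /one_minus_shift; set al := eps _ - _.
have ual : raising al by exact: raising_root.
have -> : F gam - F (gam + al) - hweight gam =
  (F gam - hweight gam) - (F (gam + al) - hweight (gam + al)) - hweight (gam + al).
  exact: sub_rearrange.
have deg_al : wdeg (gam + al) = wdeg gam by case: ual => a0 _ _; rewrite wdegD a0 addr0.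
apply: supp_inD; [apply: supp_inD; [exact: uF | apply: supp_inN] | apply: supp_inN].
  apply: (@supp_inW _ _ _ _ (uF _)) => a [lo|[be ube [gb ->]]]; first by left; rewrite -deg_al.
  by right; exists (al + be); [exact: raisingD | rewrite addrA].
by apply: supp_in_hweight => g0; right; exists al.
Qed.

Lemma unitriangular_L z F : unitriangular F -> unitriangular (one_minus_L z F).
Proof.
move=> uF gam; rewrite /one_minus_L /one_minus_shift.
have -> : F gam - F (gam - eps z) - hweight gam =
  (F gam - hweight gam) - (F (gam - eps z) - hweight (gam - eps z)) - hweight (gam - eps z).
  exact: sub_rearrange.
have lt : wdeg (gam - eps z) < wdeg gam by rewrite wdegD wdegN wdeg_eps; lia.
apply: supp_inD; [apply: supp_inD; [exact: uF | apply: supp_inN] | apply: supp_inN].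
  by apply: (@supp_inW _ _ _ _ (uF _)) => a /lower_or_raised_degree dg; left; apply: le_lt_trans lt.
by apply: supp_in_hweight => g0; left; rewrite /degree_lt degree_hmono wseq_deg.
Qed.

Lemma unitriangular_Katalan (Psi : {set 'I_l * 'I_l}) M : unitriangular (Katalan Psi M).
Proof.
rewrite /Katalan; elim: M => [|z M IH] /=; last exact: unitriangular_L.
have : forall ij, ij \in enum (posroots l :\: Psi) -> (ij.1 < ij.2)%N.
  by move=> ij; rewrite mem_enum !inE => /andP[].
elim: (enum _) => [|ij r IH] /= P; first exact: unitriangular_kprod.
apply: unitriangular_R; first by apply: P; rewrite mem_head.
by apply: IH => ij' h; apply: P; rewrite inE h orbT.
Qed.

End LeadingTerm.

(** The monomials smaller than that of [t], for the order that compares degrees and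
then, in reverse, the sums of squares of the parts.  Sums of squares are used
rather than dominance because they are not affected by sorting the parts. *)
Definition beyond (t : seq nat) (a : hmon) :=
  (degree a < sumn t)%N \/ degree a = sumn t /\ (sqsum t < sqsum (hparts a))%N.

Lemma gtilde_leading k l (lam : l.-tuple nat) : sorted geq lam ->
  supp_in (beyond lam) (gtilde k lam - hprod lam).
Proof.
move=> srt; pose gam : weight l := [ffun i => (tnth lam i)%:Z].
pose nu (i : 'I_l) : int := (tnth lam i)%:Z.
have nu_mono (i j : 'I_l) : (i < j)%N -> nu j <= nu i.
  move=> ij; rewrite /nu lez_nat !(tnth_nth 0%N).
  apply: (sorted_ltn_nth _ _ srt); rewrite ?inE ?size_tuple //.
  by move=> x y z /= yx zy; exact: leq_trans zy yx.
have g0 : nonneg gam by apply/forallP => i; rewrite ffunE.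
have wl : wseq gam = lam.
  rewrite -[RHS](map_tnth_enum lam); apply: eq_map => i.
  by rewrite ffunE.
have := @unitriangular_Katalan l nu nu_mono (Delta k lam) (Lset (Delta k lam)) gam.
rewrite /hweight g0 wl; apply: supp_inW => a [lo|[be [b0 bnu bi] [gb ->]]].
  by left; move: lo; rewrite /degree_lt -(wseq_deg g0) wl ltz_nat.
right; rewrite degree_hmono sqsum_hmono; split.
  by apply/eqP; rewrite -eqz_nat wseq_deg // wdegD b0 addr0 -(wseq_deg g0) wl.
have sqE (de : weight l) : (sqsum (wseq de))%:Z = \sum_i de i ^+ 2.
  rewrite /sqsum /wseq -map_comp sumn_image (big_morph Posz PoszD (erefl _)).
  by apply: eq_bigr => i _; rewrite -abszX gez0_abs // sqr_ge0.
rewrite -ltz_nat -[in X in X < _]wl !sqE.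
have -> : \sum_i (gam + be) i ^+ 2 =
    \sum_i gam i ^+ 2 + (dot nu be *+ 2 + \sum_i be i ^+ 2).
  rewrite /dot -sumrMnl -!big_split; apply: eq_bigr => i _ /=.
  by rewrite /nu !ffunE; ring.
rewrite ltrDl; apply: ltr_wpDl; first by rewrite mulrn_wge0.
rewrite lt_def sumr_ge0 ?andbT => [|i _]; last exact: sqr_ge0.
apply: contraTneq bi => /eqP; rewrite psumr_eq0 => [/allP z|i _]; last exact: sqr_ge0.
rewrite /dot big1 ?ltxx // => i _.
have := z i (mem_index_enum i); rewrite sqrf_eq0 => /eqP ->; exact: mulr0.
Qed.

(** * Linear independence and the expansion *)

Lemma max_on (T : eqType) (r : seq T) (f : T -> nat) : r != [::] ->
  exists2 x, x \in r & forall y, y \in r -> (f y <= f x)%N.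
Proof.
elim: r => // x [|x' r] IH _.
  by exists x; rewrite ?mem_head // => y; rewrite inE => /eqP ->.
have [//|z zr zmax] := IH.
have [xz|zx] := leqP (f x) (f z).
  by exists z => [|y]; rewrite inE ?zr ?orbT // => /predU1P[->|/zmax].
exists x => [|y]; first exact: mem_head.
by rewrite inE => /predU1P[->//|/zmax yz]; apply: leq_trans yz (ltnW zx).
Qed.

Section Independence.
Variable k : nat.
Implicit Types mu ka : kpart k.

Lemma kpart_sorted mu : sorted geq (val mu).
Proof. by case/andP: (valP mu). Qed.

Lemma kpart_gt0 mu x : x \in val mu -> (0 < x)%N.
Proof. by case/andP: (valP mu) => _ /allP mp /mp /andP[]. Qed.

Lemma hmono_kpart mu ka : hmono (val mu) = hmono (val ka) -> mu = ka.
Proof.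
move=> e; apply: val_inj; apply: (@sorted_eq _ geq); try exact: kpart_sorted.
- by move=> x y z /= yx zy; exact: leq_trans zy yx.
- by move=> x y; rewrite andbC => /anti_leq.
have pos (nu : kpart k) : [seq x <- val nu | (0 < x)%N] = val nu.
  by apply/all_filterP/allP => x /kpart_gt0.
have := perm_hparts (val mu); rewrite pos e perm_sym => /perm_trans; apply.
by have := perm_hparts (val ka); rewrite pos.
Qed.

(** Among the partitions with nonzero coefficient, choose one of largest degree, and
then of smallest sum of squares: its leading monomial occurs in no other term. *)
Lemma gtilde_part_free (D : {fset kpart k}) (d : kpart k -> rat) :
  \sum_(mu <- D) d mu *: gtilde_part mu = 0 -> forall mu, mu \in D -> d mu = 0.
Proof.
move=> sum0 mu0 mu0D; apply/eqP; apply: contraT => dmu0.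
pose r := [seq mu <- D | d mu != 0].
have r0 : r != [::].
  by apply/eqP => r0; have : mu0 \in r; [rewrite mem_filter dmu0 | rewrite r0].
(* With B larger than all sums of squares, one number encodes the order. *)
pose B := (\max_(mu <- r) sqsum (val mu)).+1.
have sqB mu : mu \in r -> (sqsum (val mu) < B)%N.
  by move=> mur; rewrite ltnS (big_rem mu mur) /= leq_maxl.
have [mu mur mumax] := max_on (fun mu => sumn (val mu) * B + (B - sqsum (val mu)))%N r0.
pose a := hmono (val mu).
have coefa ka : ka \in r ->
    monalg.mcoeff a (gtilde_part ka) = (hmono (val ka) == a)%:R.
  move=> kar; have -> : gtilde_part ka =
      (gtilde_part ka - hprod (val ka)) + hprod (val ka) by rewrite subrK.
  have e1 : monalg.mcoeff a (hprod (val ka)) = (hmono (val ka) == a)%:R.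
    by rewrite hprodE monalg.mcoeffU1.
  rewrite monalg.mcoeffD e1.
  set c := monalg.mcoeff a _; suff -> : c = 0 by rewrite add0r.
  apply/eqP; apply: contraT => c0.
  have := @gtilde_leading k _ (in_tuple (val ka)) (kpart_sorted ka) a c0.
  have := mumax ka kar; have := sqB ka kar; have := sqB mu mur.
  rewrite /beyond degree_hmono sqsum_hmono /= => lt1 lt2 le [lt|[eq lt]]; last first.
    move: le; rewrite eq; clear -lt lt1; set X := (_ * B)%N; lia.
  move: le; have : ((sumn (val mu)).+1 * B <= sumn (val ka) * B)%N by rewrite leq_mul2r lt orbT.
  rewrite mulSn; clear -lt2; move: (sumn (val mu) * B)%N (sumn (val ka) * B)%N => X Y.
  lia.
have := congr1 (monalg.mcoeff a) sum0; rewrite monalg.mcoeff0 raddf_sum /=.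
have muD : mu \in D by move: mur; rewrite mem_filter => /andP[].
rewrite (big_fsetD1 mu muD) /= [X in _ + X]big_seq [X in _ + X]big1 => [|ka]; last first.
  rewrite in_fsetD1 => /andP[ne kaD]; rewrite monalg.mcoeffZ.
  have [-> |dka] := eqVneq (d ka) 0; first exact: mul0r.
  rewrite coefa; last by rewrite mem_filter dka.
  by case: eqP => [/hmono_kpart e|_]; [rewrite e eqxx in ne | rewrite mulr0].
rewrite addr0 monalg.mcoeffZ (coefa mu mur) eqxx mulr1 => d0.
by move: mur; rewrite mem_filter d0 eqxx.
Qed.

Lemma expansion_wide (c : {fsfun kpart k -> rat with 0}) (D : {fset kpart k}) :
  (finsupp c `<=` D)%fset ->
  \sum_(mu <- finsupp c) c mu *: gtilde_part mu = \sum_(mu <- D) c mu *: gtilde_part mu.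
Proof.
move=> cD; apply: big_fset_incl => // mu _ /fsfun_dflt ->; exact: scale0r.
Qed.

Lemma gtilde_expansion_unique u (c c' : {fsfun kpart k -> rat with 0}) :
  gtilde_expansion u c -> gtilde_expansion u c' -> forall mu, c mu = c' mu.
Proof.
rewrite /gtilde_expansion => uc uc' mu; pose D := (finsupp c `|` finsupp c')%fset.
have : \sum_(mu <- D) (c mu - c' mu) *: gtilde_part mu = 0.
  have uD : u = \sum_(mu <- D) c mu *: gtilde_part mu.
    by rewrite -(expansion_wide (fsubsetUl _ _)); exact: uc.
  have uD' : u = \sum_(mu <- D) c' mu *: gtilde_part mu.
    by rewrite -(expansion_wide (fsubsetUr _ _)); exact: uc'.
  apply: (etrans _ (subrr u)); rewrite {1}uD uD' -[RHS]sumrB.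
  apply: eq_bigr => ka _; exact: scalerBl.
move=> /gtilde_part_free free; have [muD|] := boolP (mu \in D).
  by apply/eqP; rewrite -subr_eq0 free.
by rewrite in_fsetU negb_or => /andP[/fsfun_dflt -> /fsfun_dflt ->].
Qed.

(** Only the parity of [e] matters. *)
Definition alternating (e : nat) (u : Sym) := exists c : {fsfun kpart k -> rat with 0},
  gtilde_expansion u c /\ forall mu, (-1) ^+ (sumn (val mu) + e) * c mu \is a Num.nat.

Lemma alternating0 e : alternating e 0.
Proof.
exists [fsfun]; split; first by rewrite /gtilde_expansion finsupp0 big_seq_fset0.
by move=> mu; rewrite fsfunE mulr0.
Qed.

Lemma alternatingD e u w : alternating e u -> alternating e w -> alternating e (u + w).
Proof.
move=> [c [uc cP]] [d [wd dP]]; pose D := (finsupp c `|` finsupp d)%fset.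
pose f : {fsfun kpart k -> rat with 0} := [fsfun mu in D => c mu + d mu].
have fE mu : f mu = c mu + d mu.
  rewrite fsfunE; case: ifP => // /negbT; rewrite in_fsetU negb_or.
  by case/andP => /fsfun_dflt -> /fsfun_dflt ->; rewrite addr0.
exists f; split=> [|mu]; last by rewrite fE mulrDr rpredD.
rewrite /gtilde_expansion (@expansion_wide f D); last first.
  by apply/fsubsetP => mu; apply: contraTT => muD; rewrite memNfinsupp fsfunE (negPf muD).
have uD : u = \sum_(mu <- D) c mu *: gtilde_part mu.
  by rewrite -(expansion_wide (fsubsetUl _ _)); exact: uc.
have wD : w = \sum_(mu <- D) d mu *: gtilde_part mu.
  by rewrite -(expansion_wide (fsubsetUr _ _)); exact: wd.
rewrite uD wD -big_split; apply: eq_bigr => mu _.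
by rewrite fE scalerDl; reflexivity.
Qed.

Lemma alternatingZ e e' n u : alternating (e + e') u ->
  alternating e (((-1) ^+ e' * n%:R) *: u).
Proof.
move=> [c [uc cP]]; pose z : rat := (-1) ^+ e' * n%:R.
pose f : {fsfun kpart k -> rat with 0} := [fsfun mu in finsupp c => z * c mu].
have fE mu : f mu = z * c mu.
  by rewrite fsfunE; case: ifP => // /negbT /fsfun_dflt ->; rewrite mulr0.
exists f; split=> [|mu]; last first.
  have -> : (-1) ^+ (sumn (val mu) + e) * f mu =
      n%:R * ((-1) ^+ (sumn (val mu) + (e + e')) * c mu).
    by rewrite fE /z addnA [in RHS]exprD; ring.
  by rewrite rpredM ?natr_nat.
rewrite /gtilde_expansion (@expansion_wide f (finsupp c)); last first.
  by apply/fsubsetP => mu; apply: contraTT => muD; rewrite memNfinsupp fsfunE (negPf muD).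
rewrite uc scaler_sumr; apply: eq_bigr => mu _.
by rewrite fE scalerA.
Qed.

Lemma alternating_sum e (I : Type) (r : seq I) (P : pred I) (F : I -> Sym) :
  (forall i, P i -> alternating e (F i)) -> alternating e (\sum_(i <- r | P i) F i).
Proof.
by move=> PF; elim/big_rec: _ => [|i u Pi Pu]; [exact: alternating0 | apply: alternatingD; auto].
Qed.

Lemma alternating_part mu : alternating (sumn (val mu)) (gtilde_part mu).
Proof.
pose f : {fsfun kpart k -> rat with 0} := [fsfun nu in [fset mu]%fset => 1].
exists f; split=> [|nu].
  rewrite /gtilde_expansion (@expansion_wide f [fset mu]%fset).
    by rewrite big_seq_fset1 fsfunE in_fset1 eqxx scale1r.
  by apply/fsubsetP => nu; apply: contraTT => muD; rewrite memNfinsupp fsfunE (negPf muD).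
rewrite fsfunE in_fset1; case: eqP => [->|_]; last by rewrite mulr0.
by rewrite addnn -signr_odd odd_double mulr1.
Qed.

Lemma alternating_parity e e' u : odd e = odd e' -> alternating e u -> alternating e' u.
Proof.
move=> ee [c [uc cP]]; exists c; split=> // mu; have := cP mu.
by rewrite -signr_odd oddD ee -oddD signr_odd.
Qed.

Lemma alternating_gseq s : all (leq^~ k) s -> sorted geq s ->
  alternating (sumn s) (gseq k s).
Proof.
move=> sk ss; rewrite gseq_filter //; pose t := [seq a <- s | (0 < a)%N].
have st : sumn t = sumn s.
  by rewrite /t; elim: (s) => //= -[|x] r IH /=; rewrite IH.
have kt : is_kpart k t.
  apply/andP; split; first by apply: sorted_filter => // x y z /= yx zy; exact: leq_trans zy yx.
  by apply/allP => x; rewrite mem_filter => /andP[-> /(allP sk)].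
by rewrite -st; exact: (alternating_part (Sub t kt)).
Qed.
End Independence.

Lemma sumn_complement k s : all (leq^~ k) s ->
  (sumn [seq (k - a)%N | a <- s] + sumn s = k * size s)%N.
Proof.
elim: s => [|a s IH] /=; first by rewrite muln0.
by case/andP => ak /IH; rewrite mulnS; lia.
Qed.

Lemma complementK k s : all (leq^~ k) s ->
  [seq (k - a)%N | a <- [seq (k - a)%N | a <- s]] = s.
Proof.
by elim: s => //= a s IH /andP[ak /IH ->]; rewrite subKn.
Qed.

Lemma all_complement k s : all (leq^~ k) [seq (k - a)%N | a <- s].
Proof. by apply/allP => x /mapP[a _ ->]; exact: leq_subr. Qed.

Lemma alternating_krows k l s : defects k l s ->
  alternating k (k * l + sumn s) (kphi k (krows k l s)).
Proof.
move=> /and3P[/eqP sz srt sk]; pose t := [seq (k - a)%N | a <- s].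
have -> : kphi k (krows k l s) = gseq k t.
  by rewrite gseqE ?all_complement // complementK // size_map sz.
have := sumn_complement sk; rewrite -/t sz => e.
apply: (@alternating_parity _ (sumn t)); first by rewrite -e !oddD; case: odd; case: odd.
apply: alternating_gseq; first exact: all_complement.
rewrite sorted_map; apply: sub_sorted srt => x y xy /=; exact: leq_sub2l.
Qed.

Lemma mesym_xpart l d : mesym l rat d =
  \sum_(S : {set 'I_l} | #|S| == d) xpart l 0 (fun i => [exists j in S, val j == i]).
Proof.
apply: eq_bigr => S _; rewrite /xpart big_mkord big_mkcond /=; apply: eq_bigr => i _.
have -> : [exists j in S, val j == i] = (i \in S).
  apply/existsP/idP => [[j /andP[jS /eqP/val_inj <-]]//|iS].
  by exists i; rewrite iS eqxx.
by rewrite xv_ord.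
Qed.

Section Main.
Variables (k l : nat) (lam : l.-tuple nat).
Hypothesis hlam : sPkl k lam.

Let s := [seq (k - a)%N | a <- lam].

Lemma lam_le : all (leq^~ k) lam.
Proof. by case/andP: hlam => /and3P[]. Qed.

Lemma defects_lam : defects k l s.
Proof.
case/andP: hlam => /and3P[_ srt _] _.
rewrite /defects size_map size_tuple eqxx all_complement andbT /= sorted_map.
by apply: sub_sorted srt => x y /= yx; exact: leq_sub2l.
Qed.

Lemma defects_strict i : (i.+1 < l)%N -> (nth k s i < nth k s i.+1)%N.
Proof.
move=> il; case/andP: hlam => _ /(sortedP 0%N)/(_ i); rewrite size_tuple => /(_ il) /= lt.
have le : (nth 0%N lam i <= k)%N.
  by apply: (allP lam_le); apply: mem_nth; rewrite size_tuple ltnW.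
by rewrite !(nth_map 0%N) ?size_tuple //; [lia | exact: ltnW].
Qed.

(** [e_d]^perp is the sum of the products of [d] distinct lowering operators. *)
Lemma alternating_eperp d : alternating k (sumn lam + d) (eperp d (gtilde k lam)).
Proof.
rewrite (gtildeE lam_le) -/s /kphi eperp_keval -/(kphi k _) mesym_xpart mulr_suml.
rewrite [kphi k _]linear_sum /=; apply: alternating_sum => S /eqP cS.
pose P (i : nat) := [exists j in S, val j == i].
have [L [LP LE]] := expands_xpart P defects_lam defects_strict (leq0n l).
have free1 : free_from 0 (1 : mpoly l rat) by move=> w _ _; exact: rmorph1.
have := LE 1 free1; rewrite mul1r => e; rewrite -/P; rewrite e.
rewrite big_seq; apply: alternating_sum => s' /LP[ds' _ _].
have sumP : (\sum_(0 <= i < l) P i = d)%N.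
  rewrite big_mkord -cS -sum1_card [RHS]big_mkcond; apply: eq_bigr => i _ /=.
  rewrite /P; have -> : [exists j in S, val j == i] = (i \in S); last by case: (i \in S).
  apply/existsP/idP => [[j /andP[jS /eqP/val_inj <-]]//|iS].
  by exists i; rewrite iS eqxx.
rewrite sumP -[(-1) ^+ _]mulr1 mul1r; apply: (@alternatingZ k _ _ 1%N).
apply: alternating_parity (alternating_krows ds').
have := sumn_complement lam_le; rewrite -/s size_tuple => <-.
by rewrite !oddD; case: (odd (sumn s)); case: (odd (sumn s'));
  case: (odd (sumn lam)); case: (odd d).
Qed.

Lemma alternating_Gperp m : alternating k (sumn lam + m) (Gperp m (gtilde k lam)).
Proof.
apply: alternating_sum => i _; rewrite perp_ee.
have [n ->] : exists n, Gcoef m i = (-1) ^+ i * n%:R.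
  rewrite /Gcoef; case: m => [|m']; last by eexists.
  by exists ((i : nat) == 0%N); case: (i : nat) => [|j]; rewrite /= ?expr0 ?mul1r ?mulr0.
apply: alternatingZ; rewrite -addnA; exact: alternating_eperp.
Qed.

End Main.

Lemma signz_parity (a b c : nat) :
  (-1 : rat) ^ (a%:Z - b%:Z - c%:Z) = (-1) ^+ (b + (a + c)).
Proof.
rewrite !expfzDr ?oppr_eq0 ?oner_eq0 // -!invr_expz -!exprnP.
by rewrite !invr_sign -!exprD; congr (_ ^+ _); lia.
Qed.

Theorem theorem1p3 (k : nat) (hk : (0 < k)%N) (l : nat) (lam : l.-tuple nat)
    (hlam : sPkl k lam) (m : nat) :
  (exists c : {fsfun kpart k -> rat with 0},
     gtilde_expansion (Gperp m (gtilde k lam)) c) /\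
  (forall c : {fsfun kpart k -> rat with 0},
     gtilde_expansion (Gperp m (gtilde k lam)) c ->
     forall mu : kpart k,
       (-1 : rat) ^ ((sumn lam)%:Z - (sumn (val mu))%:Z - m%:Z) * c mu
         \is a Num.nat).
Proof.
have [c0 [c0E c0P]] := alternating_Gperp hlam m; split; first by exists c0.
move=> c cE mu; rewrite (gtilde_expansion_unique cE c0E) signz_parity.
exact: c0P.
Qed.
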